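(* Assume that a reference measure for $X$ exists and that $\mathbb E^x[\sup_{t\in[0,\infty]}\delta(t)f(X_t)]<\infty$ for all $x\in\mathbb R^d$. Then for any $R\in\mathcal B$ we have $\Theta(R)\in\mathcal B$.
   Context: Setting. $\mathcal B$ is the Borel $\sigma$-algebra of $\mathbb R^d$. $X=(X_t)_{t\ge0}$ is an $\mathbb R^d$-valued time-homogeneous continuous strong Markov process with transition function $(P_t)_{t\ge 0}$, realized on the path space $C([0,\infty);\mathbb R^d)$ with the universally completed filtration $\mathbb F$ (the intersection over all initial laws $\mu$ of the $\mu$-augmentations of the raw filtration generated by $X$); $\mathbb P^x,\mathbb E^x$ denote the law and expectation when $X_0=x$. The payoff $f:\mathbb R^d\to[0,\infty)$ is continuous. The discount function $\delta:[0,\infty)\to[0,1]$ is continuous, nonincreasing, with $\delta(0)=1$, $\lim_{t\to\infty}\delta(t)=0$, and $\delta(s)\delta(t)\le\delta(s+t)$ for all $s,t>0$. Convention: $\delta(\infty)f(X_\infty):=\limsup_{t\to\infty}\delta(t)f(X_t)$. For $R\in\mathcal B$, $\rho_R:=\inf\{t>0:X_t\in R\}$ ($\inf\emptyset=\infty$), $J(x,R):=\mathbb E^x[\delta(\rho_R)f(X_{\rho_R})]$, $S(R):=\{x:J(x,R)<f(x)\}$, $I(R):=\{x:J(x,R)=f(x)\}$, $\Theta(R):=S(R)\cup(I(R)\cap R)$. $R\in\mathcal B$ is of zero potential if $\int_0^\infty P_t(x,R)\,dt=0$ for all $x\in\mathbb R^d$. A reference measure for $X$ is a measure $\lambda$ on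 $(\mathbb R^d,\mathcal B)$ that is a countable sum of finite measures and such that $R\in\mathcal B$ is of zero potential if and only if $\lambda(R)=0$. *)

(* Defs.v *)
From HB Require Import structures.
From mathcomp Require Import all_boot all_order all_algebra.
From mathcomp Require Import all_classical all_reals all_analysis.

Set Implicit Arguments.
Unset Strict Implicit.
Unset Printing Implicit Defensive.

Import Order.TTheory GRing.Theory Num.Theory.
Import numFieldNormedType.Exports.

Local Open Scope classical_set_scope.
Local Open Scope ring_scope.
Local Open Scope ereal_scope.

Definition euclidean (R : realType) (d : nat) :=
  g_sigma_algebraType (@open 'rV[R]_d).

(** The half-line, as a topological space in its own right: a path has no
    value at negative times. *)
Definition time (R : realType) : set R := [set t | (0 <= t)%R].

Lemma time0 (R : realType) : (0%R : R) \in @time R.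
Proof. by rewrite inE /time/=. Qed.

(** [to_time t] is [t] for [0 <= t]; negative reals are sent to the dummy
    value [0]. *)
Definition to_time (R : realType) (t : R) : @time R :=
  insubd (exist _ 0%R (@time0 R) : @time R) t.

Definition cpath (R : realType) (d : nat) : Type :=
  continuousType (@time R) 'rV[R]_d.

Lemma cst_path_continuous (R : realType) (d : nat) :
  continuous (cst 0%R : @time R -> 'rV[R]_d).
Proof. exact: cst_continuous. Qed.

Definition cst_path (R : realType) (d : nat) : cpath R d :=
  HB.pack_for (continuousType (@time R) 'rV[R]_d)
    (cst 0%R : @time R -> 'rV[R]_d)
    (isContinuous.Build _ _ _ (@cst_path_continuous R d)).

HB.instance Definition _ (R : realType) (d : nat) := Choice.on (cpath R d).
HB.instance Definition _ (R : realType) (d : nat) :=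
  isPointed.Build (cpath R d) (cst_path R d).

(** The coordinate process [X_t]; only used at times [0 <= t]. *)
Definition path_at (R : realType) (d : nat) (t : R) (w : cpath R d)
    : euclidean R d :=
  (w : continuousType (@time R) 'rV[R]_d) (to_time t).

Definition cylinders (R : realType) (d : nat) (D : set R)
    : set (set (cpath R d)) :=
  [set C | exists2 s, D s & exists2 B : set (euclidean R d),
             measurable B & C = path_at s @^-1` B].

Definition path_space (R : realType) (d : nat) :=
  g_sigma_algebraType (@cylinders R d [set t | (0 <= t)%R]).

Section markov.
Context (R : realType) (d : nat).
Local Notation E := (euclidean R d).
Local Notation Omega := (path_space R d).

Definition raw_filtration (t : R) : set (set Omega) :=
  <<s @cylinders R d [set s | (0 <= s <= t)%R] >>.

Variable Px : R.-pker E ~> Omega.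

Definition law_from (mu : probability E R) (A : set Omega) : \bar R :=
  \int[mu]_x Px x A.

Definition augmentation (mu : probability E R) (G : set (set Omega))
    : set (set Omega) :=
  <<s G `|` (law_from mu).-negligible >>.

Definition universal_filtration (t : R) : set (set Omega) :=
  [set A | forall mu : probability E R, augmentation mu (raw_filtration t) A].

Definition universal_sigma_algebra : set (set Omega) :=
  [set A | forall mu : probability E R, augmentation mu measurable A].

Definition stopping_time (tau : Omega -> \bar R) : Prop :=
  (forall w, 0 <= tau w) /\
  (forall t : R, (0 <= t)%R ->
     universal_filtration t [set w | tau w <= t%:E]).

Definition stopped_sigma_algebra (tau : Omega -> \bar R) : set (set Omega) :=
  [set A | universal_sigma_algebra A /\
     forall t : R, (0 <= t)%R ->
       universal_filtration t (A `&` [set w | tau w <= t%:E])].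

(** The laws [Px x] live on the cylinder sigma-algebra, whereas hitting times
    of Borel sets and sets of the universally completed filtration are only
    measurable for the completion; hence probabilities and expectations are
    taken under the completed law. *)
Definition completed_law (x : E)
    : {measure set (caratheodory_type (Px x)^*%mu) -> \bar R} :=
  @completed_measure_extension _ Omega R (Px x).
Arguments completed_law _ : clear implicits.

Definition completed_expectation (x : E) (Y : Omega -> \bar R) : \bar R :=
  \int[completed_law x]_w Y w.

(** Integrated form of
    [Px x [X_(tau + t) \in B | F_tau] = P t X_tau B] almost surely on
    [tau < +oo]. *)
Definition strong_markov (P : R -> R.-pker E ~> E) : Prop :=
  forall (tau : Omega -> \bar R), stopping_time tau ->
  forall (A : set Omega), stopped_sigma_algebra tau A ->
  forall (x : E) (t : R) (B : set E), (0 <= t)%R -> measurable B ->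
    completed_law x (A `&` [set w | tau w < +oo] `&`
                     [set w | B (path_at (fine (tau w) + t) w)]) =
    \int[completed_law x]_(w in A `&` [set w | tau w < +oo])
      P t (path_at (fine (tau w)) w) B.

(** [P t] is only meaningful for [0 <= t]. *)
Definition transition_function (P : R -> R.-pker E ~> E) : Prop :=
  (forall (x : E) (B : set E), measurable B -> P 0%R x B = \d_x B) /\
  (forall (s t : R) (x : E) (B : set E),
     (0 <= s)%R -> (0 <= t)%R -> measurable B ->
     P (s + t)%R x B = \int[P s x]_y P t y B).

Record continuous_strong_markov (P : R -> R.-pker E ~> E) : Prop := {
  csm_transition : transition_function P ;
  csm_initial : forall x : E, Px x [set w | path_at 0 w = x] = 1 ;
  csm_strong_markov : strong_markov P }.

End markov.

Definition zero_potential (R : realType) (d : nat)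
    (P : R -> R.-pker (euclidean R d) ~> (euclidean R d))
    (A : set (euclidean R d)) : Prop :=
  forall x : euclidean R d,
    \int[lebesgue_measure]_(t in [set t : R | (0 <= t)%R]) P t x A = 0.

Definition is_reference_measure (R : realType) (d : nat)
    (P : R -> R.-pker (euclidean R d) ~> (euclidean R d))
    (lambda : {sfinite_measure set (euclidean R d) -> \bar R}) : Prop :=
  forall A : set (euclidean R d), measurable A ->
    (zero_potential P A <-> lambda A = 0).

Record discount_function (R : realType) (delta : R -> R) : Prop := {
  discount_continuous :
    {within [set t : R | (0 <= t)%R], continuous delta} ;
  discount_range : forall t, (0 <= t)%R -> (0 <= delta t <= 1)%R ;
  discount_nonincreasing :
    forall s t, (0 <= s)%R -> (s <= t)%R -> (delta t <= delta s)%R ;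
  discount0 : delta 0%R = 1%R ;
  discount_cvg0 : delta t @[t --> +oo%R] --> (0 : R)%R ;
  discount_submul : forall s t, (0 < s)%R -> (0 < t)%R ->
    (delta s * delta t <= delta (s + t))%R }.

Section stopping_problem.
Context (R : realType) (d : nat).
Local Notation E := (euclidean R d).
Local Notation Omega := (path_space R d).
Variables (Px : R.-pker E ~> Omega) (delta : R -> R) (f : 'rV[R]_d -> R).

(** [discounted_payoff t w] is [delta(t) f(X_t)], with the limsup convention
    at [t = +oo]; negative times are irrelevant. *)
Definition discounted_payoff (t : \bar R) (w : Omega) : \bar R :=
  match t with
  | r%:E => (delta r * f (path_at r w))%:E
  | _ => limf_esup (fun s : R => (delta s * f (path_at s w))%:E)
                   (pinfty_nbhs R)
  end.

Definition payoff_sup (w : Omega) : \bar R :=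
  ereal_sup [set discounted_payoff t w | t in [set t | 0 <= t]].

Definition hitting_time (A : set E) (w : Omega) : \bar R :=
  ereal_inf [set t%:E | t in [set t : R | (0 < t)%R /\ A (path_at t w)]].

Definition J (x : E) (A : set E) : \bar R :=
  completed_expectation Px x
    (fun w => discounted_payoff (hitting_time A w) w).

Definition stopping_S (A : set E) : set E := [set x | J x A < (f x)%:E].

Definition stopping_I (A : set E) : set E := [set x | J x A = (f x)%:E].

Definition Theta (A : set E) : set E :=
  stopping_S A `|` (stopping_I A `&` A).

End stopping_problem.

(* Main.v *)
(** Write [Y] for the discounted payoff at the hitting time of [A], so that
    [J(x, A) = E^x Y]. As [t] decreases to 0, [Y] of the path shifted by [t]
    tends to [Y], and it is dominated by the payoff supremum divided by
    [delta t] because [delta] is super-multiplicative; hence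
    [J(x, A) = lim_(t -> 0+) E^x J(X_t, A)]. Hitting events of Borel sets are
    Souslin sets over the cylinder sigma-algebra, so [J] agrees with a Borel
    function [g] outside a null set of the reference measure. Such a set has
    zero potential, so [E^x J(X_t, A) = E^x g(X_t)] for almost every [t], and
    [J(x, A)] is the limit of [n \int_0^(1/n) E^x g(X_t) dt], which is Borel
    in [x]. *)

Require Import Defs.
From HB Require Import structures.
From mathcomp Require Import all_boot all_order all_algebra.
From mathcomp Require Import all_classical all_reals all_analysis.
From mathcomp Require Import measurable_realfun.

Set Implicit Arguments.
Unset Strict Implicit.
Unset Printing Implicit Defensive.

Import Order.TTheory GRing.Theory Num.Theory.
Import numFieldNormedType.Exports.

Local Open Scope classical_set_scope.
Local Open Scope ring_scope.
Local Open Scope ereal_scope.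

(** * The Souslin operation *)

(** The obstacle is that the completion depends on the starting point: a hitting time has a
    cylinder-measurable version under each [Px x], but the exceptional set of paths varies with [x],
    and measurability in [x] is lost. The remedy is one version [tau] with one exceptional set [N]
    that serves almost every starting point: the reference measure is a sum of finite measures, and
    [N] is made null for the mixture of the laws [Px y] over each summand. The points [y] with
    [Px y N > 0] then form a null set of the reference measure. For fixed [x] the process avoids
    these points only at almost every time, and the good times depend on [x]. A fixed sequence of
    times tending to 0 would therefore not do, whereas averages over short intervals ignore the bad
    times. Transporting [N] along shifts needs the Markov property for events of the whole path,
    while [strong_markov] concerns a single later time; finite-dimensional events bridge the gap. *)

Definition souslin (T : Type) (C : set (set T)) : set (set T) :=
  [set A | exists2 G : seq nat -> set T, (forall s, C (G s)) &
     A = [set x | exists u : nat -> nat, forall n, G (mkseq u n) x]].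

Lemma mkseqS_head (u : nat -> nat) n :
  mkseq u n.+1 = u 0%N :: mkseq (fun k => u k.+1) n.
Proof.
rewrite /mkseq /= (iotaDl 1 0) -map_comp.
by congr (_ :: _); apply: eq_map => k.
Qed.

(** The first digit of a branch selects the index [i], and the remaining digits form a branch of the
    scheme of [F i]. The root carries no condition, whence [C setT]. *)
Lemma souslin_bigcup (T : Type) (C : set (set T)) (F : nat -> set T) :
  C setT -> (forall i, souslin C (F i)) -> souslin C (\bigcup_i F i).
Proof.
move=> CT GP.
pose H s := if s is i :: s' then projT1 (cid2 (GP i)) s' else setT.
have HP i : (forall s, C (H (i :: s))) /\
  F i = [set x | exists u : nat -> nat, forall n, H (i :: mkseq u n) x].
  by rewrite /H; case: cid2.
exists H; first by case=> // i s; have [] := HP i.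
apply/seteqP; split => x.
- case=> i _; rewrite (HP i).2 => -[u uP].
  exists (fun k => if k is k'.+1 then u k' else i) => -[//|n].
  by rewrite mkseqS_head.
- case=> u uP; exists (u 0%N) => //; rewrite (HP _).2.
  by exists (fun k => u k.+1) => n; have := uP n.+1; rewrite mkseqS_head.
Qed.

(** One sequence encodes countably many branches: digit [k] of branch [i] sits at position
    [pickle (i, k)]. The node [s] imposes every condition whose digits all lie within [s], and
    [setT] stands for the others, so that each node is a countable intersection of members of
    [C]. *)
Lemma souslin_bigcap (T : Type) (C : set (set T)) (F : nat -> set T) :
  C setT ->
  (forall (S : nat * nat -> set T), (forall p, C (S p)) -> C (\bigcap_p S p)) ->
  (forall i, souslin C (F i)) -> souslin C (\bigcap_i F i).
Proof.
move=> CT CI FP.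
pose G i := projT1 (cid2 (FP i)).
have GP i : (forall s, C (G i s)) /\
  F i = [set x | exists u : nat -> nat, forall n, G i (mkseq u n) x].
  by rewrite /G; case: cid2.
pose pr (i k : nat) : nat := pickle (i, k).
pose H s := \bigcap_(p : nat * nat)
  (if all (fun k => pr p.1 k < size s)%N (iota 0 p.2) then
     G p.1 (mkseq (fun k => nth 0%N s (pr p.1 k)) p.2) else setT).
exists H.
  by move=> s; apply: CI => -[i n]; case: ifP => // _; exact: (GP i).1.
apply/seteqP; split => x.
- move=> xF.
  have /boolp.choice[u uP] : forall i, exists u : nat -> nat,
      forall n, G i (mkseq u n) x.
    by move=> i; have := xF i I; rewrite (GP i).2.
  have [v vE] : exists v : nat -> nat, forall i k, v (pr i k) = u i k.
    exists (fun m => if unpickle m is Some (i, k) then u i k else 0%N) => i k.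
    by rewrite /pr pickleK.
  exists v => n [i m] _; case: ifP => // /allP im.
  rewrite (_ : mkseq _ _ = mkseq (u i) m)//.
  by apply/eq_in_map => k /im /=; have -> := size_mkseq v n => kn; rewrite nth_mkseq ?vE.
- case=> u uP i _; rewrite (GP i).2; exists (fun k => u (pr i k)) => n.
  (* [M] is a length at which the first [n] digits of branch [i] have all been read. *)
  have [M kM] : exists M, forall k, k \in iota 0 n -> (pr i k < M)%N.
    exists (\max_(k <- iota 0 n) pr i k).+1 => k kn.
    by rewrite ltnS; apply: leq_bigmax_seq.
  have := uP M (i, n) I; have sM := size_mkseq u M; rewrite /= sM.
  case: ifP => [_|/negP]; last by case; exact/allP.
  rewrite (_ : mkseq _ _ = mkseq (fun k => u (pr i k)) n)//.
  by apply/eq_in_map => k /kM kM'; rewrite nth_mkseq.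
Qed.

Lemma souslin_sub (T : Type) (C : set (set T)) : C `<=` souslin C.
Proof.
move=> A CA; exists (fun _ => A) => //.
by apply/seteqP; split => [x Ax|x [_ /(_ 0%N)]] //; exists (fun=> 0%N).
Qed.

(* Each piece of the scheme is replaced by a measurable hull; outside the
   countably many null sets where a hull is not covered by the hulls of its
   children, a point of the top hull can be followed along an infinite branch. *)
Lemma souslin_measurable d (T : measurableType d) (Z : set (set T)) (A : set T) :
  (forall F : nat -> set T, (forall n, Z (F n)) -> Z (\bigcup_n F n)) ->
  (forall S : set T, exists H, [/\ measurable H, S `<=` H &
     forall B, measurable B -> S `<=` B -> Z (H `\` B)]) ->
  souslin measurable A ->
  exists D N, [/\ measurable D, Z N, D `<=` A & A `\` D `<=` N].
Proof.
move=> ZU hull [G mG AE].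
pose As s := [set x | exists2 u : nat -> nat,
  mkseq u (size s) = s & forall n, G (mkseq u n) x].
have AG s : As s `<=` G s by move=> x [u us /(_ (size s))]; rewrite us.
have /boolp.choice[H0 H0P] := fun s => hull (As s).
pose H s := H0 s `&` G s.
have mH s : measurable (H s) by apply: measurableI => //; have [] := H0P s.
have AH s : As s `<=` H s.
  by move=> x xs; split; [have [_ + _] := H0P s; exact|exact: AG].
pose N1 s := H s `\` \bigcup_i H (rcons s i).
have ZN1 s : Z (H0 s `\` \bigcup_i H (rcons s i)).
  have [_ _] := H0P s; apply; first exact: bigcup_measurable.
  move=> x [u us uG]; exists (u (size s)) => //; apply: AH.
  by exists u; rewrite // size_rcons mkseqS us.
(* [Z] is not assumed to be closed under subsets, so [N] is built from the full hulls [H0 s] and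
   merely covers the sets [N1 s]. *)
pose F n := let s := odflt [::] (unpickle n : option (seq nat)) in
  H0 s `\` \bigcup_i H (rcons s i).
pose N := \bigcup_n F n.
have sN s : N1 s `<=` N.
  move=> x [[xs xG] xn]; exists (pickle s) => //; rewrite /F pickleK.
  by split.
have ZN : Z N by apply: ZU => n; exact: ZN1.
have mN1 : measurable (\bigcup_s N1 s).
  apply: countable_bigcupT_measurable => // s.
  by apply: measurableD => //; apply: bigcup_measurable.
exists (H [::] `\` \bigcup_s N1 s), N; split => //.
- exact: measurableD.
- move=> x [xH xN]; rewrite AE /=.
  have next s : exists i, H s x -> H (rcons s i) x.
    have [xs|] := pselect (H s x); last by exists 0%N.
    apply: contrapT => ns; apply: xN; exists s => //; split => // -[i _ xi].
    by apply: ns; exists i.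
  have /boolp.choice[c cP] := next.
  pose S := fix S n := if n is m.+1 then rcons (S m) (c (S m)) else [::].
  have HS n : H (S n) x by elim: n => //= n; exact: cP.
  exists (fun n => c (S n)) => n.
  rewrite (_ : mkseq _ _ = S n); first by have [] := HS n.
  by elim: n => // n IH; rewrite mkseqS IH.
- move=> x [Ax nx]; have xH : H [::] x.
    by apply: AH; move: Ax; rewrite AE => -[u uP]; exists u.
  by apply: contrapT => xN; apply: nx; split => // -[s _ /sN].
Qed.

(** The infimum of the measures of measurable supersets of [S] is attained by intersecting
    near-minimisers. For a measurable [B] containing [S], the set [H] intersected with [B] is again
    a competitor, so it cannot have smaller measure than [H]; finiteness of [m] allows the
    subtraction. *)
Lemma measurable_hull d (T : measurableType d) (R : realType)
    (m : {finite_measure set T -> \bar R}) (S : set T) :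
  exists H, [/\ measurable H, S `<=` H &
    forall B, measurable B -> S `<=` B -> m (H `\` B) = 0].
Proof.
pose V := [set fine (m B) | B in [set B | measurable B /\ S `<=` B]].
have hV : has_inf V.
  split; first by exists (fine (m setT)), setT.
  by exists 0%R => _ [B _ <-]; exact: fine_ge0.
have /boolp.choice[B BP] : forall n : nat, exists B, [/\ measurable B, S `<=` B &
    (fine (m B) < inf V + n.+1%:R^-1)%R].
  move=> n; have [|_ [B [mB SB] <-] h] := @inf_adherent _ V n.+1%:R^-1 _ hV.
    by rewrite invr_gt0.
  by exists B.
have mB n : measurable (B n) by have [] := BP n.
have mI : measurable (\bigcap_n B n) by apply: bigcap_measurable.
exists (\bigcap_n B n); split => //.
  by move=> x Sx n _; have [_ + _] := BP n; exact.
move=> C mC SC; set H := \bigcap_n B n.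
have SH : S `<=` H by move=> x Sx n _; have [_ + _] := BP n; exact.
have fin A : measurable A -> m A \is a fin_num by move=> mA; exact: fin_num_measure.
have mHC : measurable (H `&` C) by exact: measurableI.
have mHD : measurable (H `\` C) by exact: measurableD.
have infH : (fine (m H) <= inf V)%R.
  apply/ler_addgt0Pr => e e0.
  have [n _ ne] := near_infty_natSinv_lt (PosNum e0).
  have [_ _ /ltW h] := BP n.
  apply: (@le_trans _ _ (fine (m (B n)))).
    rewrite fine_le ?fin//; apply: le_measure; rewrite ?inE//.
    by move=> x; exact.
  by rewrite (le_trans h)// lerD2l; apply/ltW/ne => /=.
have leI : (inf V <= fine (m (H `&` C)))%R.
  apply: ge_inf; first by exact: hV.2.
  by exists (H `&` C) => //; split => // x Sx; split; [exact: SH|exact: SC].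
have := measureDI m mI mC => /(congr1 fine).
rewrite fineD ?fin// => h.
apply/eqP; rewrite -fine_eq0 ?fin//; apply/eqP/le_anti/andP; split.
  by rewrite -(lerD2r (fine (m (H `&` C)))) add0r -h (le_trans infH).
exact: fine_ge0.
Qed.

(** A whole sequence of measures is kept because the sets will have to be null for all mixtures of
    path laws over the finite summands of the reference measure at once. *)
Definition null_for d (T : measurableType d) (R : realType)
    (m : nat -> set T -> \bar R) : set (set T) :=
  [set N | measurable N /\ forall k, m k N = 0].

Lemma null_for_bigcup d (T : measurableType d) (R : realType)
    (m : nat -> {measure set T -> \bar R}) (F : nat -> set T) :
  (forall n, null_for m (F n)) -> null_for m (\bigcup_n F n).
Proof.
move=> FP; split; first by apply: bigcup_measurable => n _; have [] := FP n.
move=> k; apply: measure_negligible; last first.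
  apply: negligible_bigcup => n; have [mF F0] := FP n.
  exact: (iffRL (negligibleP (m k) mF) (F0 k)).
by apply: bigcup_measurable => n _; have [] := FP n.
Qed.

Lemma null_for_countable d (T : measurableType d) (R : realType)
    (m : nat -> {measure set T -> \bar R}) (I : countType) (F : I -> set T) :
  (forall i, null_for m (F i)) -> null_for m (\bigcup_i F i).
Proof.
move=> FP; rewrite (_ : \bigcup_i F i =
    \bigcup_n oapp F set0 (unpickle n : option I)).
  apply: null_for_bigcup => n; case: (unpickle n) => //=; split => // k; exact: measure0.
apply/seteqP; split => [x [i _ Fi]|x [n _]].
  by exists (pickle i) => //; rewrite pickleK.
by case: (unpickle _) => //= i Fi; exists i.
Qed.

(** Intersecting the hulls of the individual measures keeps the minimality of each of them. *)
Lemma null_for_hull d (T : measurableType d) (R : realType)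
    (m : nat -> {finite_measure set T -> \bar R}) (S : set T) :
  exists H, [/\ measurable H, S `<=` H &
    forall B, measurable B -> S `<=` B -> null_for m (H `\` B)].
Proof.
have /boolp.choice[H HP] := fun k => measurable_hull (m k) S.
have mI : measurable (\bigcap_n H n).
  by apply: bigcap_measurable => // k _; have [] := HP k.
exists (\bigcap_n H n); split => //.
  by move=> x Sx k _; have [_ + _] := HP k; exact.
move=> B mB SB; split; first exact: measurableD.
move=> k; have [mH _ /(_ _ mB SB) h] := HP k.
apply: (@subset_measure0 _ _ _ (m k) _ (H k `\` B)) => //; [exact: measurableD..|].
by apply: setSD => x; exact.
Qed.

(** * Borel sets as Souslin sets over the closed sets *)

Definition inner_part (R : realType) (V : normedModType R) (U : set V)
  (r : R) : set V := [set y | ball y r `<=` U].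

Lemma closed_inner_part (R : realType) (V : normedModType R) (U : set V)
  (r : R) : closed (inner_part U r).
Proof.
rewrite -openC (_ : ~` _ = \bigcup_(z in ~` U) ball z r).
  by apply: bigcup_open => z _; exact: ball_open.
apply/seteqP; split => [y /existsNP[z /not_implyP[yz zU]]|y [z zU zy] yU].
  by exists z => //; exact: ball_sym.
by apply: zU; apply: yU; exact: ball_sym.
Qed.

Lemma open_inner_part (R : realType) (V : normedModType R) (U : set V) :
  open U -> U = \bigcup_n inner_part U n.+1%:R^-1.
Proof.
move=> oU; apply/seteqP; split => [y Uy|y [n _]]; last first.
  by apply; apply: ballxx; rewrite invr_gt0.
have /nbhs_ballP[e /= e0 eU] := open_nbhs_nbhs (conj oU Uy).
have [n _ /(_ _ (leqnn n)) ne] := near_infty_natSinv_lt (PosNum e0).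
by exists n => // z /(le_ball (ltW ne)); exact: eU.
Qed.

(** Souslin sets are not stable under complement, so the induction over the sigma-algebra carries a
    set together with its complement. An open set qualifies because its complement is closed and the
    set itself is a countable union of the closed sets [inner_part]. *)
Lemma souslin_closed_measurable (R : realType) (d : nat)
    (A : set (euclidean R d)) :
  measurable A -> souslin (@closed 'rV[R]_d) A.
Proof.
pose S := [set B : set 'rV[R]_d |
  souslin (@closed 'rV[R]_d) B /\ souslin (@closed 'rV[R]_d) (~` B)].
have cT : closed [set: 'rV[R]_d] by exact: closedT.
have cI (F : nat * nat -> set 'rV[R]_d) :
  (forall p, closed (F p)) -> closed (\bigcap_p F p).
  by move=> cF; apply: closed_bigI => p _.
suff : @measurable _ (euclidean R d) `<=` S by move=> mS /mS[].
apply: smallest_sub; last first.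
  move=> U oU; split; last by apply: souslin_sub; exact: open_closedC.
  rewrite (open_inner_part oU); apply: souslin_bigcup => // n.
  by apply: souslin_sub; exact: closed_inner_part.
split.
- by split; [|rewrite setC0]; apply: souslin_sub => //; exact: closed0.
- by move=> B [sB sCB]; rewrite setTD; split; rewrite ?setCK.
- move=> F FS; split; first by apply: souslin_bigcup => // i; have [] := FS i.
  by rewrite setC_bigcup; apply: souslin_bigcap => // i; have [] := FS i.
Qed.

(** A cluster point of the finite-stage witnesses works: from stage [k] on they all lie in the
    closed set [F k]. *)
Lemma compact_decreasing (T : topologicalType) (K : set T) (F : nat -> set T) :
  compact K -> (forall n, closed (F n)) ->
  (forall n, exists2 u, K u & forall k, (k <= n)%N -> F k u) ->
  exists2 u, K u & forall k, F k u.
Proof.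
move=> cK cF Fn.
have /boolp.choice[u uP] : forall n, exists u, K u /\ forall k, (k <= n)%N -> F k u.
  by move=> n; have [u ? ?] := Fn n; exists u.
have [|x [Kx xu]] := cK (u @ \oo) _.
  by exists 0%N => // n _; have [] := uP n.
exists x => // k; apply: cF => B Bx.
apply: xu => //; exists k => // n /= kn; have [_] := uP n; exact.
Qed.

(** * Paths and shifts *)

Section paths.
Context (R : realType) (d : nat).
Local Notation E := (euclidean R d).
Local Notation Omega := (path_space R d).

Lemma val_to_time (t : R) : (0 <= t)%R -> set_val (to_time t) = t.
Proof.
move=> t0; rewrite /to_time /insubd insubT//= ?inE// => tT.
Qed.

Lemma to_time_lt0 (t : R) : (t < 0)%R -> to_time t = to_time 0%R.
Proof.
move=> t0; apply/val_inj; rewrite {1}/to_time /insubd insubF/=.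
  by rewrite -[RHS]/(set_val _) val_to_time.
by apply/negP; rewrite inE /time /= leNgt t0.
Qed.

Lemma to_time_max (t : R) : to_time t = to_time (Num.max t 0)%R.
Proof. by case: (ltP t 0%R) => // /to_time_lt0. Qed.

Lemma to_time_continuous : continuous (@to_time R).
Proof.
apply: (@continuous_comp_initial (@time R) R R set_val (@to_time R)).
rewrite (_ : set_val \o _ = (fun t : R => Num.max t 0)%R).
  move=> t; apply: continuous_max; [exact: cvg_id|exact: cvg_cst].
by apply/funext => t /=; rewrite to_time_max val_to_time// le_max lexx orbT.
Qed.

Lemma continuous_path_at (w : cpath R d) :
  continuous (fun t : R => path_at t w : 'rV[R]_d).
Proof.
move=> t; apply: (@continuous_comp _ _ _ (@to_time R) w).
  exact: to_time_continuous.
exact: cts_fun.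
Qed.

Lemma shift_subproof (t : R) (w : cpath R d) : continuous
  (fun u : @time R => (path_at (set_val u + t)%R w : 'rV[R]_d)).
Proof.
move=> u; apply: (@continuous_comp _ _ _ (set_val : @time R -> R)
  (fun r => path_at (r + t)%R w : 'rV[R]_d)).
  exact: (@initial_continuous (@time R) R set_val).
apply: (@continuous_comp _ _ _ (fun r => r + t)%R (fun t => path_at t w : 'rV[R]_d)).
  by apply: cvgD; [exact: cvg_id|exact: cvg_cst].
exact: continuous_path_at.
Qed.

Definition shift (t : R) (w : Omega) : Omega :=
  (mkcts (@shift_subproof t w) : continuousType (@time R) 'rV[R]_d).

Lemma path_at_shift (s t : R) (w : Omega) :
  (0 <= s)%R -> path_at s (shift t w) = path_at (s + t) w.
Proof. by move=> s0; rewrite /path_at/= /mkcts val_to_time. Qed.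

Lemma path_at_le0 (t : R) (w : Omega) : (t <= 0)%R -> path_at t w = path_at 0%R w.
Proof. by move=> t0; rewrite /path_at to_time_max max_r. Qed.

Lemma measurable_path_at (t : R) :
  measurable_fun [set: Omega] (path_at t : Omega -> E).
Proof.
wlog t0 : t / (0 <= t)%R => [h|].
  have [/h //|/ltW t0] := leP 0%R t.
  by rewrite (_ : path_at t = path_at 0%R);
    [exact: h|apply/funext => w; exact: path_at_le0].
move=> _ B mB; rewrite setTI; apply: sub_sigma_algebra.
by exists t => //; exists B.
Qed.

Lemma measurable_shift (t : R) : (0 <= t)%R ->
  measurable_fun [set: Omega] (shift t : Omega -> Omega).
Proof.
move=> t0; apply: measurability; first by [].
move=> _ [_ [s s0 [B mB ->]] <-]; rewrite setTI.
rewrite (_ : shift t @^-1` _ = path_at (s + t)%R @^-1` B).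
  by rewrite -[X in measurable X]setTI; exact: measurable_path_at.
by apply/funext => w; rewrite /preimage /mkset path_at_shift.
Qed.

Lemma closed_measurable_euclidean (F : set 'rV[R]_d) :
  closed F -> measurable (F : set E).
Proof.
move=> cF; rewrite -[F]setCK; apply: measurableC.
by apply: sub_sigma_algebra; exact: closed_openC.
Qed.

Lemma rat_dense_itv (a b : R) : (a < b)%R ->
  exists q : rat, (a < ratr q < b)%R.
Proof. by move=> ab; have [q] := rat_in_itvoo ab; rewrite in_itv/=; exists q. Qed.
End paths.

(** * Measurability of evaluation and of hitting events *)

Section paths_measurable.
Context (R : realType) (d : nat).
Local Notation E := (euclidean R d).
Local Notation Omega := (path_space R d).

Lemma open_rat_dense (t : R) (B : set R) :
  nbhs t B -> exists q : rat, B (ratr q).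
Proof.
move=> /nbhs_ballP[e /= e0 eB].
have /rat_dense_itv[q /andP[q1 q2]] : (t - e < t + e)%R by rewrite ltrD2l gtrN.
exists q; apply: eB; rewrite /ball/= ltr_distlC; exact/andP.
Qed.

(** By continuity of paths, [X_t] lies in the open set [U] iff for some [k] and [n] all rational
    times within [1/(n+1)] of [t] put the path in the closed set [I k]. This is a countable
    combination of measurable rectangles. *)
Lemma measurable_path_at_joint : measurable_fun [set: (R * Omega)%type]
  (fun p => path_at p.1 p.2 : E).
Proof.
apply: measurability; first by [].
move=> _ [U oU <-]; rewrite setTI.
pose I k := inner_part (U : set 'rV[R]_d) k.+1%:R^-1.
rewrite (_ : _ @^-1` _ = \bigcup_k \bigcup_n ~` \bigcup_(q : rat)
    ((fst @^-1` (ball (ratr q : R) n.+1%:R^-1)) `&`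
     (snd @^-1` (path_at (ratr q) @^-1` (~` I k))))).
  apply: bigcup_measurable => k _; apply: bigcup_measurable => n _.
  apply: measurableC; apply: countable_bigcupT_measurable => // q.
  apply: measurableI.
    rewrite -[X in measurable X]setTI; apply: measurable_fst => //.
    exact: measurable_ball.
  rewrite -[X in measurable X]setTI; apply: measurable_snd => //.
  rewrite -[X in measurable X]setTI; apply: measurable_path_at => //.
  apply: measurableC; apply: closed_measurable_euclidean.
  exact: closed_inner_part.
apply/seteqP; split => -[t w] /=.
- move=> Ut; have /nbhs_ballP[e /= e0 eU] := open_nbhs_nbhs (conj oU Ut).
  have e20 : (0 < e / 2)%R by rewrite divr_gt0.
  have [k _ /(_ _ (leqnn k)) ke] := near_infty_natSinv_lt (PosNum e20).
  have /continuous_path_at := nbhsx_ballx (path_at t w : 'rV[R]_d) _ e20.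
  move=> /nbhs_ballP[r /= r0 rX].
  have [n _ /(_ _ (leqnn n)) ne] := near_infty_natSinv_lt (PosNum r0).
  exists k => //; exists n => // -[q _ [/= tq]]; apply => z kz.
  apply: eU; rewrite [e]splitr; apply: (@ball_triangle _ _ (path_at (ratr q) w)).
    by apply: rX; apply: (le_ball (ltW ne)); exact: ball_sym.
  exact: (le_ball (ltW ke)).
- move=> [k _ [n _ nq]].
  suff : I k (path_at t w) by apply; exact: ballxx.
  apply: contrapT => nI.
  have oI : open (~` I k) by apply: closed_openC; exact: closed_inner_part.
  have h1 : nbhs t ((fun t => path_at t w : 'rV[R]_d) @^-1` (~` I k)).
    by apply: continuous_path_at; exact: open_nbhs_nbhs.
  have h2 : nbhs t (ball t n.+1%:R^-1) by exact: nbhsx_ballx.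
  have [q [q1 q2]] := open_rat_dense (filterI h1 h2).
  by apply: nq; exists q => //; split => //=; exact: ball_sym.
Qed.

(** On a compact time interval, meeting the closed set [F] amounts to coming arbitrarily close to
    [F] at rational times of the interval. These exist because [a < b]. *)
Lemma measurable_hit_closed (a b : R) (F : set 'rV[R]_d) :
  (a < b)%R -> closed F ->
  measurable [set w : Omega | exists2 u, (a <= u <= b)%R & F (path_at u w)].
Proof.
move=> ab cF.
pose O n := \bigcup_(z in F) ball z (n.+1%:R^-1 : R).
have oO n : open (O n) by apply: bigcup_open => z _; exact: ball_open.
rewrite (_ : [set w | _] = \bigcap_n \bigcup_(q : rat)
   (if (a <= ratr q <= b)%R then path_at (ratr q) @^-1` (O n) else set0)).
  apply: bigcap_measurable => // n _; apply: countable_bigcupT_measurable => // q.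
  case: ifP => // _; rewrite -[X in measurable X]setTI.
  by apply: measurable_path_at => //; exact: sub_sigma_algebra.
apply/seteqP; split => w.
- move=> [u /andP[au ub] Fu] n _.
  have h : nbhs u ((fun t => path_at t w : 'rV[R]_d) @^-1` (O n)).
    apply: continuous_path_at; apply: open_nbhs_nbhs; split => //.
    by exists (path_at u w) => //; exact: ballxx.
  have /nbhs_ballP[e /= e0 eO] := h.
  have [q /andP[q1 q2]] : exists q : rat,
      (Num.max a (u - e) < ratr q < Num.min b (u + e))%R.
    apply: rat_dense_itv; rewrite gt_max !lt_min ab/=.
    by rewrite (le_lt_trans au) ?ltrDl//= (lt_le_trans _ ub) ?gtrBl//= ltrD2l gt0_cp.
  move: q1 q2; rewrite gt_max lt_min => /andP[aq uq] /andP[qb qu].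
  exists q => //; rewrite (ltW aq) (ltW qb)/=; apply: eO.
  by rewrite /ball/= ltr_distlC uq qu.
- move=> wO.
  (* Closures make the sets [C n] closed, as the compactness argument requires; they cost the extra
     [e / 2] at the end. *)
  pose C n := (fun t => path_at t w : 'rV[R]_d) @^-1` (closure (O n)).
  have cC n : closed (C n).
    apply: closed_comp; last exact: closed_closure.
    by move=> *; exact: continuous_path_at.
  have [||u uab uC] := @compact_decreasing _ `[a, b]%classic C _ cC.
  + exact: segment_compact.
  + move=> n; have [q _] := wO n I; case: ifP => // qab qO.
    exists (ratr q); first by rewrite /= in_itv.
    move=> k kn; apply: subset_closure; case: qO => z Fz zq; exists z => //.
    by apply: le_ball zq; rewrite lef_pV2 ?posrE// ler_nat.
  + exists u; first by move: uab; rewrite /= in_itv.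
    apply: cF => B /nbhs_ballP[e /= e0 eB].
    have e20 : (0 < e / 2)%R by rewrite divr_gt0.
    have [n _ /(_ _ (leqnn n)) ne] := near_infty_natSinv_lt (PosNum e20).
    have [y [[z Fz zy] uy]] := uC n _ (nbhsx_ballx (path_at u w : 'rV[R]_d) _ e20).
    exists z; split => //; apply: eB; rewrite [e]splitr.
    apply: ball_triangle uy _; apply: (le_ball (ltW ne)); exact: ball_sym.
Qed.

(** Compactness of the time interval lets the existence of a hitting time pass inside the Souslin
    operation: times that are good for every finite prefix of a branch cluster at one time good for
    the whole branch. The new nodes intersect along prefixes so that a single time serves all
    earlier conditions together. *)
Lemma souslin_hit (a b : R) (A : set E) : (a < b)%R -> measurable A ->
  souslin (@measurable _ Omega)
    [set w | exists2 u, (a <= u <= b)%R & A (path_at u w)].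
Proof.
move=> ab /souslin_closed_measurable [G cG ->].
exists (fun s => [set w : Omega | exists2 u, (a <= u <= b)%R &
    (\bigcap_(k in [set k | (k <= size s)%N]) G (take k s)) (path_at u w)]).
  by move=> s; apply: measurable_hit_closed => //; apply: closed_bigI => k _.
apply/seteqP; split => w.
- move=> [u uab [v vG]]; exists v => n; exists u => // k /=.
  rewrite size_mkseq => kn; rewrite (_ : take _ _ = mkseq v k)//.
  by rewrite /mkseq -map_take take_iota (minn_idPl kn).
- move=> [v vG].
  pose C n := (fun t => path_at t w : 'rV[R]_d) @^-1` (G (mkseq v n)).
  have cC n : closed (C n).
    by apply: closed_comp; [move=> *; exact: continuous_path_at|exact: cG].
  have [||u uab uC] := @compact_decreasing _ `[a, b]%classic C _ cC.
  + exact: segment_compact.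
  + move=> n; have [u uab uG] := vG n; exists u; first by rewrite /= in_itv.
    move=> k kn; have := uG k; rewrite /= size_mkseq => /(_ kn).
    by rewrite /C /= /mkseq -map_take take_iota (minn_idPl kn).
  + exists u; first by move: uab; rewrite /= in_itv.
    by exists v.
Qed.

End paths_measurable.

(** * Hitting times *)

Lemma measurable_fun_countable_sup (R : realType) d (T : measurableType d)
    (I : countType) (D : set I) (F : I -> T -> \bar R) :
  (forall i, D i -> measurable_fun setT (F i)) ->
  measurable_fun setT (fun x => ereal_sup [set F i x | i in D]).
Proof.
move=> mF mT; apply: (measurability _ (ErealGenOInfty.measurableE R)) => //.
move=> _ [_ [x ->] <-]; rewrite setTI.
rewrite (_ : _ @^-1` _ = \bigcup_i
    (if pselect (D i) is left _ then F i @^-1` `]x%:E, +oo[ else set0)).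
  apply: countable_bigcupT_measurable => // i; case: pselect => // Di.
  by rewrite -[X in measurable X]setTI; apply: mF => //; exact: emeasurable_itv.
apply/seteqP; split => t /=.
  rewrite in_itv/= andbT => /ereal_sup_gt[_ [i Di <-] h].
  by exists i => //; case: pselect => // _; rewrite /= in_itv/= h.
move=> [i _]; case: pselect => // Di /=; rewrite !in_itv/= !andbT => h.
by apply: (lt_le_trans h); apply: ereal_sup_ubound; exists i.
Qed.

Lemma measurable_fun_countable_inf (R : realType) d (T : measurableType d)
    (I : countType) (D : set I) (F : I -> T -> \bar R) :
  (forall i, D i -> measurable_fun setT (F i)) ->
  measurable_fun setT (fun x => ereal_inf [set F i x | i in D]).
Proof.
move=> mF; rewrite (_ : (fun _ => _) = (fun x => - ereal_sup [set - F i x | i in D])).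
  apply: measurableT_comp => //.
  apply: (@measurable_fun_countable_sup _ _ _ _ D (fun i x => - F i x)) => i Di.
  by apply: measurableT_comp => //; exact: mF.
apply/funext => x; rewrite /ereal_inf; congr (- ereal_sup _).
by rewrite -image_comp.
Qed.

Section hitting_time.
Context (R : realType) (d : nat).
Local Notation E := (euclidean R d).
Local Notation Omega := (path_space R d).

(** The hitting time is the infimum of the right endpoints of the rational intervals during which
    the path meets [A]. Each such event is Souslin, hence contains a measurable set [D p] differing
    from it by a null set, and [tau] uses [D p] instead. Since [D p] lies inside the event, [tau] is
    never too small; only the other inequality needs [w] outside [N]. *)
Lemma hitting_time_measurable_ae (m : nat -> {finite_measure set Omega -> \bar R})
    (A : set E) : measurable A ->
  exists tau N, [/\ measurable_fun setT tau, null_for m N, (forall w, 0 <= tau w) &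
    forall w, ~ N w -> tau w = hitting_time A w].
Proof.
move=> mA.
pose hit (p : rat * rat) := [set w : Omega | exists2 u : R,
  (ratr p.1 <= u <= ratr p.2)%R & A (path_at u w)].
have /boolp.choice[D] : forall p : rat * rat, exists D, exists N,
    (ratr p.1 < ratr p.2 :> R)%R ->
    [/\ measurable D, null_for m N, D `<=` hit p & hit p `\` D `<=` N].
  move=> p; have [pp|] := boolP (ratr p.1 < ratr p.2 :> R)%R; last first.
    by move=> _; exists set0, set0.
  have := @souslin_measurable _ _ (null_for m) (hit p).
  case.
  - by move=> F; exact: null_for_bigcup.
  - exact: null_for_hull.
  - exact: souslin_hit.
  - by move=> D [N h]; exists D, N.
move=> /boolp.choice[N0 DN].
(* The left endpoint is positive because [hitting_time] disregards time 0. *)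
pose good : set (rat * rat) := [set p | (0 < (ratr p.1 : R) < ratr p.2)%R].
pose tau w : \bar R := ereal_inf
  [set (if w \in D p then (ratr p.2)%:E else +oo) | p in good].
pose N := \bigcup_(p : rat * rat)
   (if (0 < (ratr p.1 : R) < ratr p.2)%R then N0 p else set0).
exists tau, N; split.
- apply: (@measurable_fun_countable_inf _ _ _ _ good
    (fun p w => if w \in D p then (ratr p.2)%:E else +oo)) => p /andP[_ /DN[mD _ _ _]].
  apply: measurable_fun_ifT => //.
  apply: (measurable_fun_bool true).
  by rewrite setTI (_ : _ @^-1` _ = D p)//; apply/seteqP;
    split => w /=; [move/set_mem|move/mem_set].
- apply: null_for_countable => p; case: ifP => [/andP[_ /DN[]//]|_].
  by split => // k; exact: measure0.
- move=> w; apply: le_ereal_inf_tmp => _ [p /andP[p1 p2] <-].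
  by case: ifP => // _; rewrite ?leey// lee_fin (ltW (lt_trans p1 p2)).
- move=> w Nw; apply/le_anti/andP; split.
  + apply: le_ereal_inf_tmp => _ [u [u0 Au] <-].
    apply/lee_addgt0Pr => e e0.
    have [q1 /andP[q10 q1u]] := rat_dense_itv u0.
    have /rat_dense_itv[q2 /andP[uq2 q2e]] : (u < u + e)%R by rewrite ltrDl.
    apply: (@le_trans _ _ (ratr q2)%:E); last by rewrite lee_fin ltW.
    have q12 : (ratr q1 < ratr q2 :> R)%R by exact: lt_trans uq2.
    apply: ereal_inf_lbound; exists (q1, q2); first by rewrite /good /= q10 q12.
    rewrite ifT// inE; apply: contrapT => nD; apply: Nw.
    exists (q1, q2) => //=; rewrite q10 q12 /=.
    have [_ _ _] := DN (q1, q2) q12; apply; split => //.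
    by exists u => //=; rewrite !ltW.
  + apply: le_ereal_inf_tmp => _ [p /andP[p1 p2] <-]; case: ifPn => [|_]; last exact: leey.
    rewrite inE => Dw; have [_ _ /(_ _ Dw)[u /andP[u1 u2] Au] _] := DN _ p2.
    apply: (@le_trans _ _ u%:E); last by rewrite lee_fin.
    by apply: ereal_inf_lbound; exists u => //; split => //; exact: lt_le_trans u1.
Qed.
End hitting_time.

(** * Discounted payoffs *)

Section payoff.
Context (R : realType) (d : nat).
Local Notation E := (euclidean R d).
Local Notation Omega := (path_space R d).
Variables (delta : R -> R) (f : 'rV[R]_d -> R).
Hypotheses (hdelta : discount_function delta) (cf : continuous f)
  (f0 : forall x, (0 <= f x)%R).

Local Notation payoff := (discounted_payoff delta f).

Lemma discount_ge0 t : (0 <= t)%R -> (0 <= delta t)%R.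
Proof. by move=> /(discount_range hdelta)/andP[]. Qed.

(** Freezing [delta] at negative times, as [to_time] does for paths, turns continuity within the
    half-line into continuity on the whole line. *)
Definition discount_ext (t : R) : R := delta (Num.max t 0)%R.

Lemma discount_extE t : (0 <= t)%R -> discount_ext t = delta t.
Proof. by move=> t0; rewrite /discount_ext max_l. Qed.

Lemma discount_ext_continuous : continuous discount_ext.
Proof.
have := discount_continuous hdelta.
rewrite subspace_sigL_continuousP => h t.
rewrite (_ : discount_ext = sigL (@time R) delta \o @to_time R).
  apply: continuous_comp; first exact: to_time_continuous.
  exact: h.
apply/funext => u; rewrite /discount_ext /= /sigL/= to_time_max.
by rewrite val_to_time// le_max lexx orbT.
Qed.

Definition gain (w : Omega) (t : R) : R := (discount_ext t * f (path_at t w))%R.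

Lemma gainE w t : (0 <= t)%R -> (delta t * f (path_at t w))%R = gain w t.
Proof. by move=> t0; rewrite /gain discount_extE. Qed.

Lemma gain_ge0 w t : (0 <= gain w t)%R.
Proof. by rewrite mulr_ge0// discount_ge0// le_max lexx orbT. Qed.

Lemma continuous_gain w : continuous (gain w).
Proof.
move=> t; apply: cvgM; first exact: discount_ext_continuous.
apply: (@continuous_comp _ _ _ (fun t => path_at t w : 'rV[R]_d) f).
  exact: continuous_path_at.
exact: cf.
Qed.

Lemma measurable_continuous_euclidean : measurable_fun setT (f : E -> R).
Proof.
apply: (measurability _ (RGenOpens.measurableE R)) => //.
move=> _ [_ [a [b ->]] <-]; rewrite setTI; apply: sub_sigma_algebra.
by apply: open_comp => // x _; exact: cf.
Qed.

Lemma measurable_gain_joint :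
  measurable_fun setT (fun p : R * Omega => gain p.2 p.1).
Proof.
apply: measurable_funM.
  apply: (measurableT_comp (continuous_measurable_fun discount_ext_continuous)).
  exact: measurable_fst.
apply: (measurableT_comp measurable_continuous_euclidean).
exact: measurable_path_at_joint.
Qed.

Lemma measurable_gain t : measurable_fun setT (gain ^~ t).
Proof.
apply: (measurableT_comp measurable_gain_joint (g := fun w => (t, w))).
exact: measurable_pair1.
Qed.

Lemma le_of_rat (g : R -> R) (U : set R) (S : \bar R) : continuous g -> open U ->
  (forall q : rat, U (ratr q) -> (g (ratr q))%:E <= S) ->
  forall u, U u -> (g u)%:E <= S.
Proof.
move=> cg oU h u Uu; have nU := open_nbhs_nbhs (conj oU Uu).
case: S h => [r||] h; last 2 first.
- by rewrite leey.
- by have [q /h] := open_rat_dense nU.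
rewrite lee_fin leNgt; apply/negP => ru.
have : \forall t \near u, (r < g t)%R by exact: (cvgr_gt (g u) (cg u) _ ru).
move=> /(filterI nU)/open_rat_dense[q [/h + gq]].
by rewrite lee_fin leNgt gq.
Qed.

Lemma payoff_fin w r : (0 <= r)%R -> payoff r%:E w = (gain w r)%:E.
Proof. by move=> r0; rewrite /= gainE. Qed.

(** Continuity of [gain] reduces the limsup to rational times, and thus to countable infima and
    suprema, which preserve measurability in [w]. *)
Lemma payoff_infE w : payoff +oo w =
  ereal_inf [set ereal_sup [set (gain w (ratr q))%:E | q in
    [set q : rat | (n%:R < ratr q :> R)%R]] | n in [set: nat]].
Proof.
rewrite /= limf_esupE; apply/le_anti/andP; split.
- apply: le_ereal_inf_tmp => _ [n _ <-].
  apply: (@le_trans _ _ (ereal_sup ((fun s : R => (delta s * f (path_at s w))%:E) @`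
      [set s : R | (n%:R < s)%R]))).
    apply: ereal_inf_lbound; exists [set s : R | (n%:R < s)%R] => //.
    by exists n%:R; split => //; rewrite realn.
  apply: ge_ereal_sup => _ [s /= ns <-]; rewrite gainE; last first.
    by rewrite (le_trans _ (ltW ns)).
  apply: (@le_of_rat _ [set s : R | (n%:R < s)%R]) => //.
  + exact: continuous_gain.
  + by move=> q nq; apply: ereal_sup_ubound; exists q.
- apply: le_ereal_inf_tmp => _ [V [M [_ MV]] <-].
  have [n Mn] : exists n : nat, (M < n%:R)%R.
    exists (Num.bound `|M|); exact: le_lt_trans (ler_norm M) (archi_boundP (normr_ge0 M)).
  apply: (@le_trans _ _ (ereal_sup [set (gain w (ratr q))%:E | q in
    [set q : rat | (n%:R < ratr q :> R)%R]])).
    by apply: ereal_inf_lbound; exists n.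
  apply: ge_ereal_sup => _ [q /= nq <-].
  apply: ereal_sup_ubound; exists (ratr q).
    by apply: MV; exact: lt_trans nq.
  by rewrite gainE// (le_trans _ (ltW nq)).
Qed.

(** With [le_payoff_inf], this characterises the limsup as the infimum of the eventual upper bounds
    of [gain]. The cut at [Num.max M 0] removes negative times, where [delta] and [discount_ext] may
    differ. *)
Lemma payoff_inf_le w (M : R) (c : \bar R) :
  (forall s, (0 <= s)%R -> (M < s)%R -> (gain w s)%:E <= c) -> payoff +oo w <= c.
Proof.
move=> h; rewrite /= limf_esupE.
apply: (@le_trans _ _ (ereal_sup ((fun s : R => (delta s * f (path_at s w))%:E) @`
      [set s : R | (Num.max M 0 < s)%R]))).
  apply: ereal_inf_lbound; exists [set s : R | (Num.max M 0 < s)%R] => //.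
  by exists (Num.max M 0)%R; split => //; rewrite num_real.
apply: ge_ereal_sup => _ [s /= + <-]; rewrite gt_max => /andP[Ms s0].
by rewrite gainE; [apply: h => //; exact: ltW|exact: ltW].
Qed.

Lemma le_payoff_inf w (x : \bar R) :
  (forall (M : R) (c : \bar R),
    (forall s, (0 <= s)%R -> (M < s)%R -> (gain w s)%:E <= c) -> x <= c) ->
  x <= payoff +oo w.
Proof.
move=> h; rewrite /= limf_esupE; apply: le_ereal_inf_tmp => _ [V [M [_ MV]] <-].
apply: (h M) => s s0 Ms; apply: ereal_sup_ubound; exists s; first exact: MV.
by rewrite gainE.
Qed.

Lemma payoff_ge0 w t : 0 <= t -> 0 <= payoff t w.
Proof.
case: t => [r||] // r0; first by rewrite payoff_fin// lee_fin gain_ge0.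
apply: le_payoff_inf => M c h.
have s0 : (0 <= Num.max M 0 + 1)%R by rewrite addr_ge0// le_max lexx orbT.
have := h _ s0; have -> : (M < Num.max M 0 + 1)%R.
  by rewrite (@le_lt_trans _ _ (Num.max M 0)%R)// ?le_max ?lexx// ltrDl.
by move=> /(_ isT); apply: le_trans; rewrite lee_fin gain_ge0.
Qed.

Lemma measurable_payoff_at (tau : Omega -> \bar R) :
  measurable_fun setT tau -> (forall w, 0 <= tau w) ->
  measurable_fun setT (fun w => payoff (tau w) w).
Proof.
move=> mtau tau0.
rewrite (_ : (fun w => _) = (fun w => if tau w < +oo then
   (gain w (fine (tau w)))%:E else payoff +oo w)).
  apply: measurable_fun_ifT.
  - apply: (measurable_fun_bool true).
    rewrite (_ : _ @^-1` _ = [set w | tau w < +oo]); last by [].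
    exact: emeasurable_fun_infty_o.
  - apply/measurable_EFinP.
    apply: (measurableT_comp measurable_gain_joint (g := fun w => (fine (tau w), w))).
    apply: measurable_fun_pair; last exact: measurable_id.
    exact: measurableT_comp.
  - rewrite (_ : payoff +oo = fun w => ereal_inf [set ereal_sup [set (gain w (ratr q))%:E | q in
      [set q : rat | (n%:R < ratr q :> R)%R]] | n in [set: nat]]).
      apply: (@measurable_fun_countable_inf _ _ _ _ setT (fun n w =>
        ereal_sup [set (gain w (ratr q))%:E | q in [set q : rat | (n%:R < ratr q :> R)%R]])) => n _.
      apply: (@measurable_fun_countable_sup _ _ _ _ [set q : rat | (n%:R < ratr q :> R)%R]
        (fun q w => (gain w (ratr q))%:E)) => q _.
      by apply/measurable_EFinP; exact: measurable_gain.
    by apply/funext => w; exact: payoff_infE.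
apply/funext => w; have := tau0 w; case: (tau w) => [r||]//=.
  by move=> r0; rewrite ltry gainE.
Qed.

(** The value at [+oo] adds nothing, since a limsup is below the supremum over finite times. Time 0
    is rational, and the other times lie in the open half-line, where rationals suffice. *)
Lemma payoff_supE w : payoff_sup delta f w =
  ereal_sup [set (gain w (ratr q))%:E | q in [set q : rat | (0 <= ratr q :> R)%R]].
Proof.
apply/le_anti/andP; split; last first.
  apply: ge_ereal_sup => _ [q /= q0 <-].
  by apply: ereal_sup_ubound; exists (ratr q)%:E; rewrite ?payoff_fin//=.
apply: ge_ereal_sup => _ [t /= t0 <-].
have fin r : (0 <= r)%R -> (gain w r)%:E <= ereal_sup [set (gain w (ratr q))%:E
    | q in [set q : rat | (0 <= ratr q :> R)%R]].
  rewrite le_eqVlt => /predU1P[<-|r0].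
    by apply: ereal_sup_ubound; exists 0%R; rewrite /= rmorph0.
  apply: (@le_of_rat _ [set r : R | (0 < r)%R]) => //.
  - exact: continuous_gain.
  - by move=> q /= q0; apply: ereal_sup_ubound; exists q => //=; exact: ltW.
case: t t0 => [r||]// t0; first by rewrite payoff_fin// fin.
by apply: (@payoff_inf_le w 0%R) => s s0 _; exact: fin.
Qed.

Lemma measurable_payoff_sup : measurable_fun setT (payoff_sup delta f : Omega -> _).
Proof.
rewrite (_ : payoff_sup delta f = fun w =>
  ereal_sup [set (gain w (ratr q))%:E | q in [set q : rat | (0 <= ratr q :> R)%R]]).
  apply: (@measurable_fun_countable_sup _ _ _ _ [set q : rat | (0 <= ratr q :> R)%R]
        (fun q w => (gain w (ratr q))%:E)) => q _.
  by apply/measurable_EFinP; exact: measurable_gain.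
by apply/funext => w; exact: payoff_supE.
Qed.

Lemma payoff_le_sup w t : 0 <= t -> payoff t w <= payoff_sup delta f w.
Proof. by move=> t0; apply: ereal_sup_ubound; exists t. Qed.

Lemma payoff_sup_ge0 w : 0 <= payoff_sup delta f w.
Proof. by apply: le_trans (payoff_le_sup w (lexx 0)); exact: payoff_ge0. Qed.

End payoff.

(** * Payoffs of shifted paths as the shift tends to 0 *)

Section shifted_payoff.
Context (R : realType) (d : nat).
Local Notation E := (euclidean R d).
Local Notation Omega := (path_space R d).
Variables (delta : R -> R) (f : 'rV[R]_d -> R).
Hypotheses (hdelta : discount_function delta) (cf : continuous f)
  (f0 : forall x, (0 <= f x)%R).

Local Notation payoff := (discounted_payoff delta f).
Local Notation gain := (gain delta f).

Lemma gain_shift (t s : R) (w : Omega) : (0 < t)%R -> (0 <= s)%R ->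
  (delta t * gain (shift t w) s <= gain w (s + t))%R.
Proof.
move=> t0 s0; have st0 : (0 <= s + t)%R by rewrite addr_ge0// ltW.
rewrite /gain path_at_shift// !discount_extE// mulrA.
(* [discount_submul] speaks of positive times, so [s = 0] is settled by [delta 0 = 1]. *)
apply: ler_wpM2r => //; move: s0; rewrite le_eqVlt => /predU1P[<-|s0].
  by rewrite (discount0 hdelta) mulr1 add0r.
by rewrite addrC; exact: discount_submul.
Qed.

Lemma le_gain_shift (t s : R) (w : Omega) : (0 < t)%R -> (0 <= s)%R ->
  (gain w (s + t) <= gain (shift t w) s)%R.
Proof.
move=> t0 s0; have st0 : (0 <= s + t)%R by rewrite addr_ge0// ltW.
rewrite /gain path_at_shift// !discount_extE//.
apply: ler_wpM2r => //; apply: (discount_nonincreasing hdelta) => //.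
by rewrite lerDl ltW.
Qed.

(** The lower bound comes from monotonicity of [delta], the upper one from super-multiplicativity;
    they merge as [t] tends to 0, because [delta t] tends to 1. *)
Lemma payoff_inf_shift (t : R) (w : Omega) : (0 < t)%R -> (0 < delta t)%R ->
  payoff +oo w <= payoff +oo (shift t w) <= (delta t)^-1%:E * payoff +oo w.
Proof.
move=> t0 dt0; apply/andP; split.
- apply: le_payoff_inf => M c h.
  apply: (@payoff_inf_le _ _ _ _ _ (Num.max M 0 + t)%R) => s s0 Ms.
  have [Mst s0t] : (M < s - t)%R /\ (0 <= s - t)%R.
    by move: Ms; rewrite -ltrBrDr gt_max => /andP[-> /ltW].
  apply: le_trans (h _ s0t Mst).
  by rewrite lee_fin -{1}(subrK t s); exact: le_gain_shift.
- rewrite lee_pdivlMl//; apply: le_payoff_inf => M c h.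
  rewrite -lee_pdivlMl//; apply: (@payoff_inf_le _ _ _ _ _ M) => s s0 Ms.
  rewrite lee_pdivlMl// -EFinM; apply: le_trans (h (s + t)%R _ _).
  + by rewrite lee_fin gain_shift.
  + by rewrite addr_ge0// ltW.
  + by rewrite (lt_trans Ms)// ltrDl.
Qed.

Lemma payoff_shift_le (t : R) (s : \bar R) (w : Omega) :
  (0 < t)%R -> (0 < delta t)%R -> 0 <= s ->
  payoff s (shift t w) <= (delta t)^-1%:E * payoff_sup delta f w.
Proof.
move=> t0 dt0; case: s => [s||] // s0.
- rewrite lee_pdivlMl// payoff_fin// -EFinM.
  apply: (@le_trans _ _ (payoff (s + t)%:E w)).
    have st0 : (0 <= s + t)%R by rewrite addr_ge0// ltW.
    by rewrite payoff_fin// lee_fin gain_shift.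
  by apply: payoff_le_sup; rewrite lee_fin addr_ge0// ltW.
- have /andP[_ h] := payoff_inf_shift w t0 dt0; apply: (le_trans h).
  by apply: lee_wpmul2l; [rewrite lee_fin invr_ge0 ltW|exact: payoff_le_sup].
Qed.

Lemma hitting_time_ge0 (A : set E) (w : Omega) : 0 <= hitting_time A w.
Proof.
by apply: le_ereal_inf_tmp => _ [u [u0 _] <-]; rewrite lee_fin ltW.
Qed.

Lemma hitting_time_shift_ge (A : set E) (t : R) (w : Omega) : (0 < t)%R ->
  hitting_time A w <= hitting_time A (shift t w) + t%:E.
Proof.
move=> t0; rewrite -leeBlDr//; apply: le_ereal_inf_tmp => _ [u [u0 Au] <-].
rewrite leeBlDr// -EFinD; apply: ereal_inf_lbound; exists (u + t)%R => //.
by split; [rewrite addr_gt0|rewrite -path_at_shift// ltW].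
Qed.

Lemma hitting_time_shift_le (A : set E) (s t : R) (w : Omega) : (0 < t)%R ->
  (t < s)%R -> A (path_at s w) -> hitting_time A (shift t w) <= (s - t)%:E.
Proof.
move=> t0 ts As; apply: ereal_inf_lbound; exists (s - t)%R => //.
by split; [rewrite subr_gt0|rewrite path_at_shift ?subrK// subr_ge0 ltW].
Qed.

(** If the path never hits [A], neither do its shifts, and [payoff_inf_shift] squeezes; finiteness
    of [payoff_sup] makes the limiting product harmless. Otherwise the hitting times of the shifted
    paths converge to that of the path, and continuity concludes. *)
Lemma cvg_payoff_shift (A : set E) (w : Omega) (t_ : nat -> R) :
  payoff_sup delta f w < +oo -> (forall n, 0 < t_ n)%R -> t_ @ \oo --> (0 : R)%R ->
  payoff (hitting_time A (shift (t_ n) w)) (shift (t_ n) w) @[n --> \oo] -->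
  payoff (hitting_time A w) w.
Proof.
move=> Zw t0 tcvg.
have dcvg : delta (t_ n) @[n --> \oo] --> (1 : R)%R.
  have -> : 1%R = discount_ext delta 0%R by rewrite discount_extE// (discount0 hdelta).
  rewrite (_ : (fun n => _) = (discount_ext delta) \o t_); last first.
    by apply/funext => n /=; rewrite discount_extE// ltW.
  apply: continuous_cvg => //; exact: discount_ext_continuous.
have d0 : \forall n \near \oo, (0 < delta (t_ n))%R.
  by apply: (cvgr_gt _ dcvg); exact: ltr01.
have h0 := hitting_time_ge0 A w.
case hE : (hitting_time A w) => [r||]; last 2 first.
- have fL : payoff +oo w \is a fin_num.
    rewrite ge0_fin_numE; last exact: payoff_ge0.
    by apply: le_lt_trans Zw; exact: payoff_le_sup.
  have hs n : hitting_time A (shift (t_ n) w) = +oo.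
    apply/eqP; rewrite -leye_eq; have := hitting_time_shift_ge A w (t0 n).
    by rewrite hE -leeBlDr// addye.
  under eq_fun do rewrite hs.
  apply: (@squeeze_cvge _ _ _ _ (cst (payoff +oo w)) _
      (fun n => (delta (t_ n))^-1%:E * payoff +oo w)).
  + near=> n; apply: payoff_inf_shift => //; near: n; exact: d0.
  + exact: cvg_cst.
  + rewrite -[X in _ --> X]mul1e; apply: cvgeMr => //.
    apply: cvg_EFin; first by near=> n.
    rewrite -[X in _ --> X]invr1; apply: cvgV => //; exact: oner_neq0.
- by move: h0; rewrite hE.
pose rho n := fine (hitting_time A (shift (t_ n) w)).
have r0 : (0 <= r)%R by rewrite -lee_fin -hE.
have near_e e : (0 < e)%R -> \forall n \near \oo,
    hitting_time A (shift (t_ n) w) = (rho n)%:E /\ (`|r - rho n| < e)%R.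
  (* The hit at time [s] survives the shift as soon as [t_ n < s]. This happens eventually even when
     [r = 0], since hits count only at positive times. *)
  move=> e0; have : hitting_time A w < (r + e)%:E by rewrite hE lte_fin ltrDl.
  move=> /ereal_inf_lt[_ [s [s0 As] <-]]; rewrite lte_fin => sr.
  have ts : \forall n \near \oo, (t_ n < s)%R by exact: (cvgr_lt _ tcvg _ s0).
  have te : \forall n \near \oo, (t_ n < e)%R by exact: (cvgr_lt _ tcvg _ e0).
  near=> n.
  have tsn : (t_ n < s)%R by near: n.
  have ten : (t_ n < e)%R by near: n.
  have le := hitting_time_shift_le (t0 n) tsn As.
  have ge := hitting_time_shift_ge A w (t0 n).
  have fn : hitting_time A (shift (t_ n) w) \is a fin_num.
    by rewrite ge0_fin_numE ?hitting_time_ge0//; exact: le_lt_trans le (ltry _).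
  rewrite /rho fineK//; split => //.
  move: le ge; rewrite hE -(fineK fn) -EFinD !lee_fin fineK// => le ge.
  rewrite ltr_distl; apply/andP; split.
    by rewrite ltrBlDr (le_lt_trans le)// ltrBlDr (lt_le_trans sr)//
      -addrA lerD2l addrC lerDr ltW.
  rewrite (le_lt_trans ge)// ltrD2l//.
have rcvg : rho @ \oo --> r.
  by apply/cvgrPdist_lt => e /near_e; apply: filterS => n [].
have fin : \forall n \near \oo, hitting_time A (shift (t_ n) w) = (rho n)%:E.
  by have := near_e _ ltr01; apply: filterS => n [].
rewrite payoff_fin//.
have : (discount_ext delta (rho n) * f (path_at (rho n + t_ n) w))%:E
    @[n --> \oo] --> (gain w r)%:E.
  apply: cvg_EFin; first by near=> n.
  apply: cvgM.
    apply: continuous_cvg => //; exact: discount_ext_continuous.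
  have rt : (rho n + t_ n)%R @[n --> \oo] --> r.
    by rewrite -[X in _ --> X]addr0; exact: cvgD.
  apply: (cvg_comp (fun n => rho n + t_ n)%R (fun t => f (path_at t w)) rt).
  apply: (@continuous_comp _ _ _ (fun t => path_at t w : 'rV[R]_d) f).
    exact: continuous_path_at.
  exact: cf.
apply: cvg_trans; apply: near_eq_cvg; near=> n.
have hn : hitting_time A (shift (t_ n) w) = (rho n)%:E by near: n.
have rn0 : (0 <= rho n)%R by rewrite fine_ge0// hitting_time_ge0.
by rewrite hn payoff_fin// /gain path_at_shift.
Unshelve. all: by end_near. Qed.

End shifted_payoff.

(** * Mixtures and completions of measures *)

Section mixture.
Context d1 d2 (S : measurableType d1) (T : measurableType d2) (R : realType).
Variables (mu : {measure set S -> \bar R}) (k : S -> {measure set T -> \bar R}).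
Variables (D : set S) (mD : measurable D).
Hypothesis mk : forall U, measurable U -> measurable_fun setT (k ^~ U).

(** The two proofs appear as arguments so that the measure structure below can be attached to the
    term. *)
Definition mixture of measurable D &
    (forall U, measurable U -> measurable_fun setT (k ^~ U)) :=
  fun U : set T => \int[mu]_(x in D) k x U.

Local Notation mix := (mixture mD mk).

Let mkD U : measurable U -> measurable_fun D (k ^~ U).
Proof. by move=> mU; apply: measurable_funTS; exact: mk. Qed.

Let mixture0 : mix set0 = 0.
Proof. by rewrite /mixture; under eq_integral do rewrite measure0; exact: integral0. Qed.

Let mixture_ge0 U : 0 <= mix U.
Proof. exact: integral_ge0. Qed.

Let mixture_semi_sigma_additive : semi_sigma_additive mix.
Proof.
move=> F mF tF mUF; rewrite /mixture.
have -> : \int[mu]_(x in D) k x (\bigcup_n F n) =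
    \sum_(n <oo) \int[mu]_(x in D) k x (F n).
  rewrite -integral_nneseries//; last by move=> n; exact: mkD.
  by apply: eq_integral => x _; rewrite measure_semi_bigcup.
by apply: is_cvg_ereal_nneg_natsum => n _; exact: integral_ge0.
Qed.

HB.instance Definition _ := isMeasure.Build _ _ _ mix
  mixture0 mixture_ge0 mixture_semi_sigma_additive.

Import HBNNSimple.

Lemma integral_mixture (h : T -> \bar R) : measurable_fun setT h ->
  (forall y, 0 <= h y) ->
  \int[mix]_y h y = \int[mu]_(x in D) \int[k x]_y h y.
Proof.
move=> mh h0.
pose g := nnsfun_approx measurableT mh.
pose gE := fun n => EFin \o g n.
have mgE n : measurable_fun [set: T] (gE n) by exact/measurable_EFinP.
have gE_ge0 n x : 0 <= gE n x by rewrite lee_fin.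
have nd_gE x : {homo gE ^~ x : n m / (n <= m)%O >-> n <= m}.
  by move=> *; exact/lefP/nd_nnsfun_approx.
transitivity (limn (fun n => \int[mix]_x gE n x)).
  rewrite -monotone_convergence//; apply: eq_integral => t _.
  by apply/esym/cvg_lim => //; exact: cvg_nnsfun_approx.
transitivity (limn (fun n => \int[mu]_(x in D) \int[k x]_y gE n y)).
  apply: congr_lim; apply/funext => n.
  rewrite integralT_nnsfun sintegralE.
  under [RHS]eq_integral do rewrite integralT_nnsfun sintegralE.
  rewrite ge0_integral_fsum//; last 2 first.
    by move=> r; apply: measurable_funeM; exact: mkD.
    by move=> n0 x _; exact: nnsfun_mulemu_ge0.
  apply: eq_fsbigr => r rh; rewrite /mixture.
  (* A nonnegative simple function has empty fibres over negative values. *)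
  have [r0|r0] := leP 0%R r; last first.
    rewrite preimage_nnfun0//; under [RHS]eq_integral do rewrite measure0 mule0.
    by rewrite integral0 [X in _ * X](_ : _ = 0) ?mule0// -[LHS]/(mix set0) measure0.
  by rewrite ge0_integralZl//; exact: mkD.
rewrite -[LHS]monotone_convergence//; last 3 first.
  by move=> n; apply: measurable_funTS; exact: measurable_fun_integral_kernel.
  by move=> n x _; exact: integral_ge0.
  by move=> x _ m n mn; apply: ge0_le_integral => // t _; exact: nd_gE.
apply: eq_integral => x _.
rewrite -monotone_convergence//.
apply: eq_integral => t _.
by apply/cvg_lim => //; exact: cvg_nnsfun_approx.
Qed.

End mixture.

(** This carries a Markov identity from events to nonnegative functions. Composition with a map is
    covered too, as integration against a Dirac kernel. *)
Lemma eq_integral_mixture d1 d2 d3 (S1 : measurableType d1) (S2 : measurableType d2)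
    (T : measurableType d3) (R : realType)
    (m1 : {measure set S1 -> \bar R}) (m2 : {measure set S2 -> \bar R})
    (k1 : S1 -> {measure set T -> \bar R}) (k2 : S2 -> {measure set T -> \bar R})
    (D1 : set S1) (D2 : set S2) (h : T -> \bar R) :
  measurable D1 -> measurable D2 ->
  (forall U, measurable U -> measurable_fun setT (k1 ^~ U)) ->
  (forall U, measurable U -> measurable_fun setT (k2 ^~ U)) ->
  (forall U, measurable U ->
    \int[m1]_(x in D1) k1 x U = \int[m2]_(x in D2) k2 x U) ->
  measurable_fun setT h -> (forall y, 0 <= h y) ->
  \int[m1]_(x in D1) \int[k1 x]_y h y = \int[m2]_(x in D2) \int[k2 x]_y h y.
Proof.
move=> mD1 mD2 mk1 mk2 k12 mh h0.
rewrite -(integral_mixture m1 mD1 mk1)// -(integral_mixture m2 mD2 mk2)//.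
by apply: eq_measure_integral => U mU _; exact: k12.
Qed.

(** * Integrals under the completed measure *)

Section completion.
Context d (T : measurableType d) (R : realType) (mu : {measure set T -> \bar R}).
Local Notation cmu := (@completed_measure_extension _ T R mu).

Lemma completed_measureE (A : set T) : measurable A -> cmu A = mu A.
Proof. by move=> mA; rewrite /completed_measure_extension measurable_mu_extE. Qed.

Lemma measurable_completed_id :
  measurable_fun setT (id : caratheodory_type (mu^*)%mu -> T).
Proof.
by move=> _ B mB; rewrite setTI preimage_id; exact: caratheodory_measurable_mu_ext.
Qed.

(** The identity from the completed space to the original one is measurable and pushes the completed
    measure forward to [mu]. *)
Lemma ge0_integral_completed (D : set T) (h : T -> \bar R) : measurable D ->
  measurable_fun D h -> (forall x, 0 <= h x) ->
  \int[cmu]_(x in D) h x = \int[mu]_(x in D) h x.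
Proof.
move=> mD mh h0.
have := @ge0_integral_pushforward _ _ _ _ _ _ measurable_completed_id cmu D h mD mh.
rewrite preimage_id => <-; last by move=> *; exact: h0.
apply: eq_measure_integral; first exact: measurable_completed_id.
by move=> mid A mA _; exact: completed_measureE.
Qed.

(** No measurability of [g] is asked for: it agrees almost everywhere with [h], which is enough for
    a complete measure. *)
Lemma ae_integral_completed (N : set T) (g h : T -> \bar R) : measurable N ->
  mu N = 0 -> measurable_fun setT h -> (forall x, 0 <= g x) -> (forall x, 0 <= h x) ->
  (forall x, ~ N x -> g x = h x) ->
  \int[cmu]_x g x = \int[mu]_x h x.
Proof.
move=> mN N0 mh g0 h0 gh.
have hg : ae_eq cmu setT h g.
  exists N; split; first exact: caratheodory_measurable_mu_ext.
  - exact: etrans (completed_measureE mN) N0.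
  - by move=> x /= /not_implyP[_ hgx]; apply: contrapT => /gh gE; apply: hgx.
have mhc : measurable_fun (setT : set (caratheodory_type (mu^*)%mu)) h.
  exact: (measurableT_comp mh measurable_completed_id).
rewrite -ge0_integral_completed//; apply/esym/ge0_ae_eq_integral => //.
apply: (ae_measurable_fun _ hg mhc).
exact: measure_is_complete_caratheodory.
Qed.
End completion.

(** * The Markov property *)

Section markov_property.
Context (R : realType) (d : nat).
Local Notation E := (euclidean R d).
Local Notation Omega := (path_space R d).
Variables (P : R -> R.-pker E ~> E) (Px : R.-pker E ~> Omega).
Hypothesis hP : continuous_strong_markov Px P.

Local Notation F := (@raw_filtration R d).

Lemma raw_filtration_measurable s : F s `<=` @measurable _ Omega.
Proof.
apply: sub_sigma_algebra2 => _ [u /andP[u0 _] [B mB ->]].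
by exists u => //; exists B.
Qed.

Lemma raw_filtration_le s t : (s <= t)%R -> F s `<=` F t.
Proof.
move=> st; apply: sub_sigma_algebra2 => _ [u /andP[u0 us] [B mB ->]].
by exists u; [rewrite /= u0 (le_trans us)|exists B].
Qed.

Lemma raw_filtration_path_at (s u : R) (B : set E) : (0 <= u <= s)%R ->
  measurable B -> F s (path_at u @^-1` B).
Proof. by move=> us mB; apply: sub_sigma_algebra; exists u => //; exists B. Qed.

Lemma sigma_algebra_all (T : Type) (G : set (set T)) (B : Prop) :
  <<s G >> [set _ : T | B].
Proof.
have [s0 sC _] := smallest_sigma_algebra setT G.
have [b|b] := pselect B.
  rewrite (_ : [set _ | B] = setT `\` set0); first exact: sC.
  by rewrite setD0; apply/seteqP; split.
by rewrite (_ : [set _ | B] = set0)//; apply/seteqP; split.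
Qed.

Lemma raw_filtrationI s A B : F s A -> F s B -> F s (A `&` B).
Proof.
have [s0 sC sU] := smallest_sigma_algebra [set: Omega]
  (@cylinders R d [set u | (0 <= u <= s)%R]).
move=> FA FB; rewrite -[A]setCK -[B]setCK -setCU -setTD; apply: (sC).
rewrite -bigcup2E; apply: sU => -[|[|n]] //=; rewrite -setTD; exact: sC.
Qed.

(** This is [strong_markov] at the constant time [s]. All events involved are measurable for the
    cylinder sigma-algebra, so the completed law may be replaced by [Px x]. *)
Lemma simple_markov_transition (s t : R) (A : set Omega) (x : E) (B : set E) :
  (0 <= s)%R -> (0 <= t)%R -> F s A -> measurable B ->
  Px x (A `&` path_at (s + t) @^-1` B) =
  \int[Px x]_(w in A) P t (path_at s w) B.
Proof.
move=> s0 t0 FA mB.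
have aug u (C : set Omega) : F u C -> universal_filtration Px u C.
  by move=> FC mu; apply: sub_sigma_algebra; left.
have st : stopping_time Px (cst s%:E).
  split; first by move=> w; rewrite lee_fin.
  move=> u u0; apply: aug.
  exact: (@sigma_algebra_all Omega _ (s%:E <= u%:E)).
have mA : measurable A by exact: raw_filtration_measurable FA.
have sA : stopped_sigma_algebra Px (cst s%:E) A.
  split; first by move=> mu; apply: sub_sigma_algebra; left.
  (* The event that the constant time is at most [u] is everything or nothing, so the intersection
     is [A] or empty. *)
  move=> u u0; apply: aug; have [su|us] := leP s u.
    rewrite (_ : _ `&` _ = A); first exact: raw_filtration_le FA.
    by apply/seteqP; split => [w []//|w Aw]; split => //=; rewrite lee_fin.
  rewrite (_ : _ `&` _ = [set _ | False]); first exact: (@sigma_algebra_all Omega _ False).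
  by apply/seteqP; split => [w [_]|w []] /=; rewrite lee_fin leNgt us.
have := csm_strong_markov hP st sA x t0 mB.
rewrite (_ : A `&` [set w | cst s%:E w < +oo] = A); last first.
  by apply/seteqP; split => [w []//|w Aw]; split => //=; rewrite ltry.
have mS : measurable (path_at (s + t) @^-1` B : set Omega).
  by rewrite -[X in measurable X]setTI; exact: measurable_path_at.
rewrite [LHS](_ : _ = Px x (A `&` path_at (s + t) @^-1` B)).
  move=> ->; apply: ge0_integral_completed => //.
  apply: measurable_funTS.
  apply: (measurableT_comp (measurable_kernel (P t) B mB)).
  exact: measurable_path_at.
by rewrite -completed_measureE//; exact: measurableI.
Qed.

Lemma integral_initial (h : E -> \bar R) (x : E) : measurable_fun setT h ->
  (forall y, 0 <= h y) -> \int[Px x]_w h (path_at 0%R w) = h x.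
Proof.
move=> mh h0.
pose D : set Omega := [set w | path_at 0%R w = x].
have mD : measurable D.
  rewrite (_ : D = path_at 0%R @^-1` [set x]); last by [].
  rewrite -[X in measurable X]setTI; apply: measurable_path_at => //.
  apply: (@closed_measurable_euclidean R d [set (x : 'rV[R]_d)]).
  exact: (@accessible_closed_set1 _
    (@hausdorff_accessible _ (@norm_hausdorff R 'rV[R]_d)) x).
have D0 : Px x (~` D) = 0.
  have PT : Px x [set: Omega] = 1 by exact: prob_kernel.
  have D1 : Px x D = 1 by exact: (csm_initial hP x).
  have := @measureD _ Omega R (Px x) setT D measurableT mD.
  rewrite setTD setTI.
  have fT : Px x [set: Omega] < +oo by rewrite PT ltry.
  move=> /(_ fT) ->; apply: etrans (congr2 (fun a b : \bar R => a - b) PT D1) _.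
  by rewrite subee.
rewrite (@ae_eq_integral _ _ _ (Px x) _ (cst (h x)))//.
- by rewrite integral_cst// prob_kernel mule1.
- by apply: (measurableT_comp mh); exact: measurable_path_at.
- exists (~` D); split => //; first exact: measurableC.
  by move=> w /= nw e; apply: nw => _; rewrite e.
Qed.

(** The Markov property at time 0, combined with the path starting at [x] almost surely. *)
Lemma transition_law (t : R) (x : E) (B : set E) : (0 <= t)%R -> measurable B ->
  P t x B = Px x (path_at t @^-1` B).
Proof.
move=> t0 mB.
have h : F 0%R setT by exact: (@sigma_algebra_all Omega _ True).
have := simple_markov_transition x (lexx 0%R) t0 h mB.
rewrite setTI add0r => ->; rewrite (integral_initial x (h := fun y => P t y B))//.
exact: measurable_kernel.
Qed.

Lemma measurable_law (C : set Omega) (s : R) : measurable C ->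
  measurable_fun setT (fun w : Omega => Px (path_at s w) C).
Proof.
move=> mC; apply: (measurableT_comp (measurable_kernel Px C mC)).
exact: measurable_path_at.
Qed.

Lemma measurable_preimage_path_at (t : R) (B : set E) : measurable B ->
  measurable (path_at t @^-1` B : set Omega).
Proof. by move=> mB; rewrite -[X in measurable X]setTI; exact: measurable_path_at. Qed.

Lemma simple_markov (s t : R) (A : set Omega) (x : E) (h : E -> \bar R) :
  (0 <= s)%R -> (0 <= t)%R -> F s A -> measurable_fun setT h ->
  (forall y, 0 <= h y) ->
  \int[Px x]_(w in A) h (path_at (s + t) w) =
  \int[Px x]_(w in A) \int[Px (path_at s w)]_v h (path_at t v).
Proof.
move=> s0 t0 FA mh h0.
have mA : measurable A by exact: raw_filtration_measurable FA.
have mp := @measurable_path_at R d t.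
(* Both sides become mixtures over [A]: of the point masses at [X_(s+t)], and of the laws of [X_t]
   under [Px] started from [X_s]. *)
pose k1 (w : Omega) : {measure set E -> \bar R} := dirac (path_at (s + t) w : E).
pose k2' (w : Omega) : {measure set E -> \bar R} :=
  pushforward (Px (path_at s w)) (path_at t : Omega -> E).
pose k2 := k2' mp.
transitivity (\int[Px x]_(w in A) \int[k1 w]_y h y).
  by apply: eq_integral => w _; rewrite integral_dirac// diracT mul1e.
transitivity (\int[Px x]_(w in A) \int[k2 w]_y h y); last first.
  by apply: eq_integral => w _; rewrite ge0_integral_pushforward.
apply: eq_integral_mixture => //.
- move=> U mU; rewrite /k1 /dirac.
  apply/measurable_EFinP; apply: (measurableT_comp (measurable_indic mU)).
  exact: measurable_path_at.
- by move=> U mU; apply: measurable_law; exact: measurable_preimage_path_at.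
- move=> U mU; transitivity (\int[Px x]_(w in A) P t (path_at s w) U).
    rewrite -simple_markov_transition//.
    rewrite (setIC A) -integral_indic//.
    exact: measurable_preimage_path_at.
  by apply: eq_integral => w _; rewrite transition_law.
Qed.
End markov_property.

(** * The Markov property for whole paths *)

Section markov_shift.
Context (R : realType) (d : nat).
Local Notation E := (euclidean R d).
Local Notation Omega := (path_space R d).
Variables (P : R -> R.-pker E ~> E) (Px : R.-pker E ~> Omega).
Hypothesis hP : continuous_strong_markov Px P.

Local Notation F := (@raw_filtration R d).

(** Constraints are indexed by time rather than by position in the list, so sorting or repeating
    times leaves the event unchanged; [s] is a common offset. *)
Definition fdd (l : seq R) (B : R -> set E) (s : R) : set Omega :=
  [set w | forall u, u \in l -> B u (path_at (s + u)%R w)].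

Lemma fdd_cons u l B s :
  fdd (u :: l) B s = path_at (s + u)%R @^-1` B u `&` fdd l B s.
Proof.
apply/seteqP; split => w.
  move=> h; split; first by apply: h; rewrite mem_head.
  by move=> v vl; apply: h; rewrite in_cons vl orbT.
by move=> [hu hl] v; rewrite in_cons => /predU1P[->|/hl].
Qed.

Lemma measurable_fdd l B s : (forall u, measurable (B u)) -> measurable (fdd l B s).
Proof.
move=> mB; elim: l => [|u l IH].
  by rewrite (_ : fdd _ _ _ = setT)//; apply/seteqP; split.
by rewrite fdd_cons; apply: measurableI => //; exact: measurable_preimage_path_at.
Qed.

(* [l] lists absolute times above the base time [r], so that moving the base
   time to the head of the list leaves the tail unchanged. *)
Lemma markov_fdd (B : R -> set E) (l : seq R) (r s : R) (A : set Omega) (x : E) :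
  (forall u, measurable (B u)) -> path <=%R r l -> (0 <= s)%R -> F s A ->
  Px x (A `&` fdd l B (s - r)%R) =
  \int[Px x]_(w in A) Px (path_at s w) (fdd l B (- r)%R).
Proof.
move=> mB; elim: l r s A x => [r s A x _ s0 FA|u l IH r s A x /= /andP[ru pl] s0 FA].
  have e v : fdd [::] B v = setT by apply/seteqP; split.
  rewrite !e setIT; under eq_integral do rewrite prob_kernel.
  rewrite integral_cst ?mul1e//; exact: raw_filtration_measurable FA.
have mA : measurable A by exact: raw_filtration_measurable FA.
pose t := (u - r)%R; have t0 : (0 <= t)%R by rewrite subr_ge0.
(* [h] is the probability of meeting all constraints, seen from the state at the first listed time.
   The claim [step] serves twice, from [x] at time [s] and from [path_at s w] at time 0;
   [simple_markov] joins the two. *)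
pose h y := ((fun y => Px y (fdd l B (- u)%R)) \_ (B u)) y.
have step y v C : (0 <= v)%R -> F v C ->
    Px y (C `&` fdd (u :: l) B (v - r)%R) =
    \int[Px y]_(w in C) h (path_at (v + t)%R w).
  move=> v0 FC; rewrite fdd_cons setIA
    (_ : v - r + u = v + t)%R; last by rewrite /t addrA addrAC.
  rewrite (_ : v - r = v + t - u)%R; last by rewrite /t addrA addrAC addrK.
  rewrite IH//; last 2 first.
  - by rewrite addr_ge0.
  - apply: raw_filtrationI; first by apply: raw_filtration_le FC; rewrite lerDl.
    by apply: raw_filtration_path_at => //; rewrite lexx addr_ge0.
  by rewrite integral_mkcondr; exact: eq_integral.
rewrite step// (simple_markov hP)//; last 2 first.
- apply/measurable_restrict => //; apply: measurable_funTS.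
  by apply: measurable_kernel; exact: measurable_fdd.
- by move=> y; rewrite /h /patch; case: ifP.
apply: eq_integral => w _.
have := step (path_at s w) 0%R setT (lexx 0%R) (@sigma_algebra_all Omega _ True).
by rewrite setTI !add0r.
Qed.

Definition fdd_class : set (set Omega) := [set C | exists l B,
  [/\ all (fun u => 0 <= u)%R l, forall u, measurable (B u) & C = fdd l B 0%R]].

Lemma fdd_classI : setI_closed fdd_class.
Proof.
move=> _ _ [l1 [B1 [l10 mB1 ->]]] [l2 [B2 [l20 mB2 ->]]].
exists (l1 ++ l2), (fun u => (if u \in l1 then B1 u else setT) `&`
  (if u \in l2 then B2 u else setT)); split.
- by rewrite all_cat l10.
- by move=> u; apply: measurableI; case: ifP.
- apply/seteqP; split => w.
    move=> [h1 h2] u _; split; case: ifP => // ul; [exact: h1|exact: h2].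
  move=> h; split => u ul; have := h u; rewrite mem_cat ul ?orbT => /(_ isT);
    by case.
Qed.

Lemma measurable_fdd_class : @measurable _ Omega = <<s fdd_class >>.
Proof.
apply/seteqP; split.
  apply: sub_sigma_algebra2 => _ [t t0 [B mB ->]].
  exists [:: t], (fun=> B); split => //=; first by rewrite andbT.
  apply/seteqP; split => w /=; last by move=> /(_ t (mem_head _ _)); rewrite add0r.
  by move=> Bw u; rewrite inE => /eqP ->; rewrite add0r.
apply: smallest_sub; first exact: sigma_algebra_measurable.
by move=> _ [l [B [_ mB ->]]]; exact: measurable_fdd.
Qed.

(** Both sides are probability measures in [C], and the finite-dimensional events form a generating
    pi-system, on which [markov_fdd] applies once the times are sorted. *)
Lemma markov_shift (t : R) (x : E) (C : set Omega) : (0 <= t)%R -> measurable C ->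
  Px x (shift t @^-1` C) = \int[Px x]_w Px (path_at t w) C.
Proof.
move=> t0 mC; rewrite measurable_fdd_class in mC; move: C mC.
have msh (C : set Omega) : measurable C -> measurable (shift t @^-1` C).
  by move=> mC; rewrite -[X in measurable X]setTI; exact: measurable_shift.
apply: (dynkin_induction measurable_fdd_class fdd_classI).
- rewrite preimage_setT prob_kernel.
  by under eq_integral do rewrite prob_kernel; rewrite integral_cst// prob_kernel mule1.
- move=> _ [l [B [l0 mB ->]]]; pose l' := sort <=%R l.
  have e s : fdd l B s = fdd l' B s.
    by apply/seteqP; split => w h u ul; apply: h; rewrite ?mem_sort// in ul *.
  rewrite !e; have := @markov_fdd B l' 0%R t setT x mB _ t0 (@sigma_algebra_all Omega _ True).
  rewrite oppr0 addr0 setTI => <-.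
    congr (Px x _); apply/seteqP; split => w h u ul; have := h u ul.
      by rewrite path_at_shift add0r ?[(u + t)%R]addrC// (allP l0)// -(mem_sort <=%R).
    by rewrite path_at_shift add0r ?[(u + t)%R]addrC// (allP l0)// -(mem_sort <=%R).
  by rewrite path_min_sorted ?all_sort//; exact: sort_le_sorted.
- move=> C mC IH; rewrite preimage_setC.
  have compl y D : measurable D -> Px y (~` D) + Px y D = 1.
    move=> mD; rewrite -measureU ?setvU//; last 2 first.
    + exact: measurableC.
    + by rewrite setICl.
    exact: prob_kernel.
  have fC : Px x (shift t @^-1` C) \is a fin_num.
    rewrite ge0_fin_numE//; have := compl x _ (msh _ mC).
    by rewrite addeC => h; rewrite (@le_lt_trans _ _ 1)// ?ltry// -h leeDl.
  rewrite -[LHS](addeK _ fC) compl; last exact: msh.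
  rewrite -[RHS](addeK _ fC); congr (_ - _).
  rewrite IH -ge0_integralD//; last 2 first.
  - by apply: measurable_law; exact: measurableC.
  - exact: measurable_law.
  under eq_integral do rewrite compl//.
  by rewrite integral_cst// prob_kernel mule1.
- move=> G mG tG IH; rewrite preimage_bigcup measure_semi_bigcup//; last 3 first.
  + by move=> n; exact: msh.
  + apply/trivIsetP => /= i j _ _ ij; rewrite -preimage_setI.
    by move/trivIsetP : tG => /(_ _ _ _ _ ij) ->//; rewrite preimage_set0.
  + by apply: bigcup_measurable => n _; exact: msh.
  transitivity (\int[Px x]_w (\sum_(n <oo) Px (path_at t w) (G n))); last first.
    apply: eq_integral => w _; rewrite measure_semi_bigcup//.
    exact: bigcup_measurable.
  rewrite integral_nneseries//; last by move=> n; exact: measurable_law.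
  by apply: eq_eseriesr => n _; exact: IH.
Qed.
End markov_shift.

(** * Occupation averages *)

Section finite_measure_of.
Context d (T : measurableType d) (R : realType) (m : {measure set T -> \bar R}).
Hypothesis fm : m setT < +oo.

Definition finite_copy of m setT < +oo : set T -> \bar R := m.

Local Notation m' := (finite_copy fm).

HB.instance Definition _ := isMeasure.Build _ _ _ m'
  (measure0 m) (measure_ge0 m) (@measure_semi_sigma_additive _ _ _ m).

Let m'_fin : fin_num_fun m'.
Proof. exact: lty_fin_num_fun. Qed.

HB.instance Definition _ := @Measure_isFinite.Build _ _ _ m' m'_fin.

Lemma finite_measure_of : exists m' : {finite_measure set T -> \bar R},
  forall U, m' U = m U.
Proof. by exists m'. Qed.
End finite_measure_of.

Lemma ae_impl d (T : measurableType d) (R : realType)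
    (mu : {measure set T -> \bar R}) (P Q : T -> Prop) :
  (forall x, P x -> Q x) -> {ae mu, forall x, P x} -> {ae mu, forall x, Q x}.
Proof.
move=> PQ [N [mN N0 PN]]; exists N; split => //.
by apply: subset_trans PN; apply: subsetC => x; exact: PQ.
Qed.

(** The bounds on [phi] are asked for almost every [t] only, which is all that zero potential can
    supply. *)
Lemma cvg_right_average (R : realType) (phi : R -> \bar R) (j : R) :
  measurable_fun setT phi -> (forall t, 0 <= phi t) ->
  (forall e, (0 < e)%R -> exists2 eta, (0 < eta)%R &
    {ae lebesgue_measure, forall t, (0 < t < eta)%R ->
      (j - e)%:E <= phi t <= (j + e)%:E}) ->
  (n.+1%:R%:E * \int[lebesgue_measure]_(t in `]0%R, n.+1%:R^-1%R[) phi t)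
    @[n --> \oo] --> j%:E.
Proof.
move=> mphi phi0 h.
have bound e : (0 < e)%R -> \forall n \near \oo,
    (j - e)%:E <= n.+1%:R%:E * \int[lebesgue_measure]_(t in `]0%R, n.+1%:R^-1%R[) phi t
      <= (j + e)%:E.
  move=> e0; have [eta eta0 ae_eta] := h e e0.
  near=> n.
  have neta : (n.+1%:R^-1 < eta)%R by near: n; exact: near_infty_natSinv_lt (PosNum eta0).
  set I := [set` `]0%R, n.+1%:R^-1%R[].
  have mI : measurable I by exact: measurable_itv.
  have n0 : (0 < n.+1%:R :> R)%R by rewrite ltr0n.
  have lI c : n.+1%:R%:E * \int[lebesgue_measure]_(t in I) (cst c%:E) t = c%:E.
    rewrite integral_cst//; transitivity (n.+1%:R%:E * (c%:E * (n.+1%:R^-1)%:E) : \bar R).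
      congr (_ * (_ * _)); apply: etrans (lebesgue_measure_itv _) _.
      by rewrite /= lte_fin invr_gt0 n0 -EFinB subr0.
    by rewrite -!EFinM mulrCA mulfV ?mulr1// gt_eqF.
  have mphiI : measurable_fun I phi by exact: measurable_funTS.
  have aeI : {ae lebesgue_measure, forall t, I t ->
      (j - e)%:E <= phi t <= (j + e)%:E}.
    move: ae_eta; apply: ae_impl => t + It; apply; move: It.
    by rewrite /I/= in_itv/= => /andP[-> /lt_trans]; exact.
  (* Comparison of integrals is applied to nonnegative functions, so the lower bound is raised to 0,
     still below [phi]. *)
  pose c := Num.max (j - e)%R 0%R.
  apply/andP; split.
  - apply: (@le_trans _ _ c%:E); first by rewrite lee_fin le_max lexx.
    rewrite -(lI c) lee_pmul2l//; apply: ae_ge0_le_integral => //.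
    + by move=> t _; rewrite lee_fin le_max lexx orbT.
    + move: aeI; apply: ae_impl => t + It => /(_ It)/andP[jt _].
      rewrite /c /cst EFin_max ge_max jt; exact: phi0.
  - have [je|je] := leP 0%R (j + e)%R.
      rewrite -(lI (j + e)%R) lee_pmul2l//; apply: ae_ge0_le_integral => //.
      by move: aeI; apply: ae_impl => t + It => /(_ It)/andP[].
    (* Here [j + e < 0] contradicts [phi >= 0] at almost every point of [I], so [phi] may be
       declared almost everywhere equal to the constant. *)
    rewrite -(lI (j + e)%R) lee_pmul2l//
      (@ae_eq_integral _ _ _ lebesgue_measure I (cst (j+e)%:E))//.
    move: aeI; apply: ae_impl => t + It => /(_ It)/andP[_ jt].
    by have := le_trans (phi0 t) jt; rewrite lee_fin leNgt je.
apply/fine_cvgP; split.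
  have := bound _ ltr01; apply: filterS => n /andP[n1 n2].
  rewrite fin_numElt (lt_le_trans _ n1) ?ltNyr//=.
  by rewrite (le_lt_trans n2)// ltry.
apply/cvgrPdist_le => e e0; have := bound _ e0; apply: filterS => n /andP[n1 n2] /=.
have fn : n.+1%:R%:E * \int[lebesgue_measure]_(t in `]0%R, n.+1%:R^-1%R[) phi t
    \is a fin_num.
  rewrite fin_numElt (lt_le_trans _ n1) ?ltNyr//=.
  by rewrite (le_lt_trans n2)// ltry.
move: n1 n2; rewrite -(fineK fn) !lee_fin => n1 n2.
by rewrite ler_distlC n1.
Unshelve. all: by end_near. Qed.

Section kernels.
Context (R : realType) (d : nat).
Local Notation E := (euclidean R d).
Local Notation Omega := (path_space R d).
Variables (P : R -> R.-pker E ~> E) (Px : R.-pker E ~> Omega).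
Hypothesis hP : continuous_strong_markov Px P.

Lemma finite_law x : exists m : {finite_measure set Omega -> \bar R},
  forall U, m U = Px x U.
Proof. by apply: finite_measure_of; rewrite prob_kernel ltry. Qed.

Lemma markov_integral (t : R) (x : E) (h : Omega -> \bar R) : (0 <= t)%R ->
  measurable_fun setT h -> (forall w, 0 <= h w) ->
  \int[Px x]_w h (shift t w) = \int[Px x]_w \int[Px (path_at t w)]_v h v.
Proof.
move=> t0 mh h0; have msh := @measurable_shift R d t t0.
transitivity (\int[Px x]_w \int[dirac (shift t w)]_v h v).
  by apply: eq_integral => w _; rewrite integral_dirac// diracT mul1e.
apply: eq_integral_mixture => //.
- move=> U mU; apply/measurable_EFinP.
  exact: (measurableT_comp (measurable_indic mU) msh).
- by move=> U mU; exact: measurable_law.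
- move=> U mU; rewrite -(markov_shift hP)//.
  rewrite -[shift t @^-1` U]setIT -integral_indic//.
  by rewrite -[X in measurable X]setTI; exact: msh.
Qed.

Definition space_time (g : E -> \bar R) (p : R * Omega) := g (path_at p.1 p.2).

Lemma measurable_space_time (g : E -> \bar R) :
  measurable_fun setT g -> measurable_fun setT (space_time g).
Proof. by move=> mg; apply: (measurableT_comp mg); exact: measurable_path_at_joint. Qed.

Lemma measurable_time_marginal (g : E -> \bar R) (x : E) :
  measurable_fun setT g -> (forall y, 0 <= g y) ->
  measurable_fun setT (fun t => \int[Px x]_w g (path_at t w)).
Proof.
move=> mg g0; have [m mE] := finite_law x.
have := @measurable_fun_fubini_tonelli_F _ _ _ _ R m _ (measurable_space_time mg) (fun=> g0 _).
rewrite (_ : fubini_F _ _ = fun t => \int[Px x]_w g (path_at t w))//.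
by apply/funext => t; apply: eq_measure_integral => U _ _; exact: mE.
Qed.

(** Tonelli moves the time integral inside: it becomes a measurable function of the path, whose
    integral against the kernel [Px] is measurable in [x]. *)
Lemma measurable_occupation (g : E -> \bar R) (I : set R) :
  measurable_fun setT g -> (forall y, 0 <= g y) -> measurable I ->
  measurable_fun setT (fun x =>
    \int[lebesgue_measure]_(t in I) \int[Px x]_w g (path_at t w)).
Proof.
move=> mg g0 mI.
pose f (p : R * Omega) := (space_time g \_ (fst @^-1` I)) p.
have mf : measurable_fun setT f.
  have mfst : measurable_fun setT (fst : R * Omega -> R) := measurable_fst.
  have mfI : measurable (fst @^-1` I : set (R * Omega)).
    by have := mfst measurableT I mI; rewrite setTI.
  apply: (iffLR (measurable_restrictT (space_time g) mfI)).
  by apply: measurable_funTS; apply: measurable_space_time.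
have f0 p : 0 <= f p by rewrite /f /patch; case: ifP => // _; exact: g0.
have mG := @measurable_fun_fubini_tonelli_G _ _ _ _ R lebesgue_measure _ mf f0.
rewrite (_ : (fun x => _) = fun x => \int[Px x]_w fubini_G lebesgue_measure f w).
  apply: measurable_fun_integral_kernel => //; first exact: measurable_kernel.
  by move=> w; exact: integral_ge0.
apply/funext => x; have [m mE] := finite_law x.
have mPx h : \int[m]_w h w = \int[Px x]_w h w.
  by apply: eq_measure_integral => U _ _; exact: mE.
rewrite -mPx -[RHS](@fubini_tonelli _ _ _ _ R lebesgue_measure m f mf f0).
rewrite integral_mkcond; apply: eq_integral => t _; rewrite mPx /f /patch.
case: ifPn => [tI|tI].
  by apply: eq_integral => w _; rewrite ifT//; apply/mem_set/set_mem.
rewrite integral0_eq// => w _; case: ifP => // /set_mem/= /mem_set.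
by rewrite (negbTE tI).
Qed.

(** A nonnegative function with zero integral vanishes almost everywhere. Its measurability in [t]
    comes from the joint measurability of the paths, nothing being assumed about [t] in
    [P t x N]. *)
Lemma zero_potential_ae (N : set E) (x : E) : measurable N -> zero_potential P N ->
  {ae lebesgue_measure, forall t : R, (0 <= t)%R -> Px x (path_at t @^-1` N) = 0}.
Proof.
move=> mN zN.
have mi : measurable_fun setT (fun y : E => (\1_N y)%:E : \bar R).
  exact/measurable_EFinP/measurable_indic.
have PE t : \int[Px x]_w (\1_N (path_at t w))%:E = Px x (path_at t @^-1` N).
  rewrite -[path_at t @^-1` N]setIT -integral_indic//.
  exact: measurable_preimage_path_at.
have i0 (y : E) : 0 <= (\1_N y)%:E :> \bar R by rewrite lee_fin.
have mphi := @measurable_time_marginal _ x mi i0.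
have mt : measurable [set t : R | (0 <= t)%R].
  by rewrite -set_itvcy; exact: measurable_itv.
have mf : measurable_fun [set t : R | (0 <= t)%R]
    (fun t => Px x (path_at t @^-1` N)).
  apply: measurable_funTS; rewrite (_ : (fun t => Px x _) =
    fun t => \int[Px x]_w (\1_N (path_at t w))%:E)//.
  by apply/funext => t; rewrite PE.
apply: (iffLR (ae_eq_integral_abs lebesgue_measure mt mf)).
rewrite -[RHS](zN x); apply: eq_integral => t; rewrite inE/= => t0.
by rewrite gee0_abs// (transition_law hP).
Qed.
End kernels.

(** * Measurability of [J] *)

Lemma ae_impl2 d (T : measurableType d) (R : realType)
    (mu : {measure set T -> \bar R}) (P Q S : T -> Prop) :
  (forall x, P x -> Q x -> S x) -> {ae mu, forall x, P x} ->
  {ae mu, forall x, Q x} -> {ae mu, forall x, S x}.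
Proof.
move=> PQS [N [mN N0 PN]] [M [mM M0 QM]]; exists (N `|` M); split.
- exact: measurableU.
- by rewrite measureU0.
- move=> x /= nS; apply: contrapT => /not_orP[nN nM]; apply: nS; apply: PQS.
    by apply: contrapT => /PN.
  by apply: contrapT => /QM.
Qed.

Section main.
Context (R : realType) (d : nat).
Local Notation E := (euclidean R d).
Local Notation Omega := (path_space R d).
Variables (P : R -> R.-pker E ~> E) (Px : R.-pker E ~> Omega).
Variables (f : 'rV[R]_d -> R) (delta : R -> R).
Hypotheses (hP : continuous_strong_markov Px P) (cf : continuous f)
  (f0 : forall x, (0 <= f x)%R) (hdelta : discount_function delta).

Local Notation payoff := (discounted_payoff delta f).
Local Notation Z := (payoff_sup delta f).

Lemma measurable_charged (N : set Omega) : measurable N ->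
  measurable [set y | 0 < Px y N].
Proof.
move=> mN; rewrite -[X in measurable X]setTI.
by apply: emeasurable_fun_o_infty => //; exact: measurable_kernel.
Qed.

(** Mixing [Px] over the finite summand [ln n] gives the finite path measure [m n]. As [N] is null
    for it, [Px y N = 0] for [ln n]-almost every [y]; summing over [n] gives a null set of
    [lambda]. *)
Lemma hitting_time_reference (lambda : {sfinite_measure set E -> \bar R})
    (A : set E) : is_reference_measure P lambda -> measurable A ->
  exists tau N, [/\ measurable_fun setT tau, (forall w, 0 <= tau w), measurable N,
    (forall w, ~ N w -> tau w = hitting_time A w) &
    zero_potential P [set y | 0 < Px y N]].
Proof.
move=> ref mA; pose ln := sfinite_measure_seq lambda.
have /boolp.choice[m mE] : forall n, exists m : {finite_measure set Omega -> \bar R},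
    forall U, m U = \int[ln n]_y Px y U.
  move=> n; apply: (@finite_measure_of _ _ _
    (mixture (ln n) measurableT (measurable_kernel Px))).
  rewrite /= /mixture; under eq_integral do rewrite prob_kernel.
  by rewrite integral_cst// mul1e ltey_eq fin_num_measure.
have [tau [N [mtau [mN N0] tau0 tauE]]] := hitting_time_measurable_ae m mA.
exists tau, N; split => //; have mC := measurable_charged mN.
apply/(ref _ mC); rewrite (sfinite_measure_seqP lambda mC) /mseries.
apply: eseries0 => n _ _.
apply: (@measure_negligible _ _ _ (ln n)) => //.
have : \int[ln n]_y `|Px y N| = 0.
  by rewrite -[RHS](N0 n) mE; apply: eq_integral => y _; rewrite gee0_abs.
move/(ae_eq_integral_abs (ln n) measurableT (measurable_kernel Px N mN)).
apply: negligibleS => y /= Py /(_ I) PyN; by move: Py; rewrite PyN ltxx.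
Qed.

(** [Y] is adapted to the single law [Px x]. It evaluates [J] at this [x], but varies with [x] and
    so says nothing about measurability in [x]. *)
Lemma expected_payoff (x : E) (A : set E) : measurable A ->
  exists Y N, [/\ measurable_fun setT Y, (forall w, 0 <= Y w <= Z w),
    measurable N /\ Px x N = 0,
    (forall w, ~ N w -> Y w = payoff (hitting_time A w) w) &
    J Px delta f x A = \int[Px x]_w Y w].
Proof.
move=> mA; have [m mE] := finite_law Px x.
have [tau [N [mtau [mN N0] tau0 tauE]]] := hitting_time_measurable_ae (fun=> m) mA.
have PN : Px x N = 0 by rewrite -mE; exact: N0 0%N.
have YE w : ~ N w -> payoff (tau w) w = payoff (hitting_time A w) w.
  by move=> /tauE ->.
exists (fun w => payoff (tau w) w), N; split => //.
- exact: measurable_payoff_at.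
- by move=> w; rewrite payoff_ge0//= payoff_le_sup.
- apply: (ae_integral_completed mN PN).
  + exact: measurable_payoff_at.
  + by move=> w; apply: payoff_ge0 => //; exact: hitting_time_ge0.
  + by move=> w; exact: payoff_ge0.
  + by move=> w /YE.
Qed.

Lemma payoff_sup_integrable (x : E) :
  completed_expectation Px x Z < +oo -> (Px x).-integrable setT Z.
Proof.
move=> Zoo; apply/integrableP; split; first exact: measurable_payoff_sup.
under eq_integral do rewrite gee0_abs ?payoff_sup_ge0//.
rewrite -ge0_integral_completed//; first exact: measurable_payoff_sup.
by move=> w; exact: payoff_sup_ge0.
Qed.

Lemma charged_shift (N : set Omega) (t : R) (x : E) : (0 <= t)%R -> measurable N ->
  Px x (path_at t @^-1` [set y | 0 < Px y N]) = 0 -> Px x (shift t @^-1` N) = 0.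
Proof.
move=> t0 mN Pt; rewrite (markov_shift hP)//.
have mC := measurable_preimage_path_at t (measurable_charged mN).
rewrite (@ae_eq_integral _ _ _ (Px x) _ (cst 0)) ?integral0//.
  exact: measurable_law.
exists (path_at t @^-1` [set y | 0 < Px y N]); split => //.
move=> w /= /not_implyP[_ nw]; rewrite lt0e measure_ge0 andbT.
by apply/eqP.
Qed.

(** Two versions meet here: [Y], exact under [Px x], represents the limit, and the universal [tau]
    represents the shifted payoffs, being exact at every time [t] at which [X_t] avoids the bad
    starting points. *)
Lemma J_right_limit (x : E) (A : set E) (tau : Omega -> \bar R) (N : set Omega) :
  measurable A -> completed_expectation Px x Z < +oo ->
  measurable_fun setT tau -> (forall w, 0 <= tau w) -> measurable N ->
  (forall w, ~ N w -> tau w = hitting_time A w) ->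
  exists2 j, J Px delta f x A = j%:E &
  forall e, (0 < e)%R -> exists2 eta, (0 < eta)%R & forall t, (0 < t < eta)%R ->
    Px x (path_at t @^-1` [set y | 0 < Px y N]) = 0 ->
    (j - e)%:E <= \int[Px x]_w \int[Px (path_at t w)]_v payoff (tau v) v
      <= (j + e)%:E.
Proof.
move=> mA Zoo mtau tau0 mN tauE.
have [Y [M [mY YZ [mM M0] YE JE]]] := expected_payoff x mA.
have iZ := payoff_sup_integrable Zoo.
have mZ := @measurable_payoff_sup R d delta f hdelta cf.
have mtp := measurable_payoff_at hdelta cf mtau tau0.
have fJ : J Px delta f x A \is a fin_num.
  rewrite JE ge0_fin_numE; last by apply: integral_ge0 => w _; have /andP[] := YZ w.
  apply: (@le_lt_trans _ _ (\int[Px x]_w Z w)).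
    by apply: ge0_le_integral => // w _; have /andP[] := YZ w.
  rewrite -ge0_integral_completed//; by move=> w; exact: payoff_sup_ge0.
exists (fine (J Px delta f x A)); first by rewrite fineK.
set j := fine _.
(* Near 0 the discount exceeds 1/2, so twice the payoff supremum dominates all shifted payoffs. *)
have [eta0 eta00 deta0] : exists2 eta0, (0 < eta0)%R &
    forall t, (0 < t < eta0)%R -> (2^-1 < delta t)%R.
  have d1 : (2^-1 < discount_ext delta 0)%R.
    by rewrite discount_extE// (discount0 hdelta) invf_lt1// ltr1n.
  have d0 : discount_ext delta t @[t --> (0 : R)%R] --> discount_ext delta 0%R.
    exact: discount_ext_continuous.
  have : nbhs (0 : R)%R [set t | (2^-1 < discount_ext delta t)%R] by exact: (cvgr_gt _ d0).
  move=> /nbhs_ballP[eta0 /= eta00 h]; exists eta0 => // t /andP[t0 t1].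
  rewrite -(discount_extE delta (ltW t0)); apply: h.
  by rewrite /ball/= sub0r normrN gtr0_norm.
(* Failure of the claim yields a sequence of good times tending to 0 along which the bound fails;
   dominated convergence along it gives the contradiction. *)
move=> e e0; apply: contrapT => nh.
have /boolp.choice[t_ tP] : forall n : nat, exists t, [/\ (0 < t < eta0)%R,
    (t < n.+1%:R^-1)%R, Px x (path_at t @^-1` [set y | 0 < Px y N]) = 0 &
    ~ ((j - e)%:E <= \int[Px x]_w \int[Px (path_at t w)]_v payoff (tau v) v
      <= (j + e)%:E)].
  move=> n; apply: contrapT => nt; apply: nh.
  exists (Num.min eta0 n.+1%:R^-1)%R; first by rewrite lt_min eta00 invr_gt0 ltr0n.
  move=> t; rewrite lt_min => /and3P[t0 t1 t2] good.
  by apply: contrapT => nb; apply: nt; exists t; split => //; rewrite t0 t1.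
have t0 n : (0 < t_ n)%R by have [/andP[]] := tP n.
have tcvg : t_ @ \oo --> (0 : R)%R.
  apply/cvgrPdist_lt => r r0; near=> n.
  rewrite sub0r normrN gtr0_norm//; have [_ tn _ _] := tP n.
  by apply: (lt_trans tn); near: n; exact: near_infty_natSinv_lt (PosNum r0).
have msh n := @measurable_shift R d (t_ n) (ltW (t0 n)).
pose Yn n w := payoff (tau (shift (t_ n) w)) (shift (t_ n) w).
have mYn n : measurable_fun setT (Yn n) by exact: (measurableT_comp mtp (msh n)).
(* Only countably many shifts occur, so their exceptional sets, null by [charged_shift], have a null
   union. *)
have aeN : {ae Px x, forall w, ~ M w /\ forall n, ~ N (shift (t_ n) w)}.
  have mS n : measurable (shift (t_ n) @^-1` N).
    by rewrite -[X in measurable X]setTI; exact: msh.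
  have S0 n : Px x (shift (t_ n) @^-1` N) = 0.
    by have [_ _ good _] := tP n; apply: charged_shift => //; exact: ltW.
  exists (M `|` \bigcup_n (shift (t_ n) @^-1` N)); split.
  - by apply: measurableU => //; exact: bigcupT_measurable.
  - rewrite measureU0//; first exact: bigcupT_measurable.
    apply: measure_negligible; first exact: bigcupT_measurable.
    apply: negligible_bigcup => n.
    exact: (iffRL (negligibleP (Px x) (mS n)) (S0 n)).
  - move=> w /= nw; apply: contrapT => /not_orP[wM wN]; apply: nw; split => //.
    by move=> n wn; apply: wN; exists n.
have YnE w n : ~ N (shift (t_ n) w) -> Yn n w =
    payoff (hitting_time A (shift (t_ n) w)) (shift (t_ n) w).
  by move=> /tauE; rewrite /Yn => ->.
have aeZ := integrable_ae measurableT iZ.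
have dt n : (2^-1 < delta (t_ n))%R by have [/deta0] := tP n.
have [] := @dominated_convergence _ _ _ (Px x) setT measurableT Yn Y
  (fun w => 2%:E * Z w) mYn mY.
- apply: ae_impl2 aeN aeZ => w [wM wN] /(_ I) fZ _; rewrite YE//.
  rewrite (_ : (fun n => Yn n w) = fun n =>
    payoff (hitting_time A (shift (t_ n) w)) (shift (t_ n) w)).
    apply: cvg_payoff_shift => //; rewrite -ge0_fin_numE//; exact: payoff_sup_ge0.
  by apply/funext => n; rewrite YnE.
- exact: integrableZl.
- apply: aeW => w n _; rewrite gee0_abs; last exact: payoff_ge0.
  have d0 : (0 < delta (t_ n))%R by rewrite (lt_trans _ (dt n))// invr_gt0.
  apply: (le_trans (payoff_shift_le hdelta f0 w (t0 n) d0 (tau0 (shift (t_ n) w)))).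
  apply: lee_wpmul2r; first exact: payoff_sup_ge0.
  by rewrite lee_fin -[leRHS]invrK lef_pV2 ?posrE ?invr_gt0// ltW.
move=> _ _; rewrite -JE -(fineK fJ) -/j => /fine_cvgP[fn] /cvgrPdist_lt /(_ e e0).
move=> h; have [n [fn_n hn]] := filter_ex (filterI fn h).
have [_ _ _] := tP n; apply.
have Y0 w : 0 <= payoff (tau w) w by exact: payoff_ge0.
rewrite -(markov_integral hP x (ltW (t0 n)) mtp Y0).
have fI : \int[Px x]_w Yn n w \is a fin_num := fn_n.
rewrite -/(Yn n) -(fineK fI) !lee_fin.
by move: hn; rewrite ltr_distlC => /andP[/ltW -> /ltW ->].
Unshelve. all: by end_near. Qed.

Lemma measurable_J (A : set E) :
  (exists lambda : {sfinite_measure set E -> \bar R}, is_reference_measure P lambda) ->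
  (forall x, completed_expectation Px x Z < +oo) -> measurable A ->
  measurable_fun setT (fun x => J Px delta f x A).
Proof.
move=> [lambda ref] Zoo mA.
have [tau [N [mtau tau0 mN tauE zN]]] := hitting_time_reference ref mA.
pose Y w := payoff (tau w) w.
have mY : measurable_fun setT Y by exact: measurable_payoff_at.
have Y0 w : 0 <= Y w by exact: payoff_ge0.
pose g y := \int[Px y]_v Y v.
have mg : measurable_fun setT g.
  by apply: measurable_fun_integral_kernel => //; exact: measurable_kernel.
have g0 y : 0 <= g y by exact: integral_ge0.
(* The convergence holds at every [x]; only the discarded null set of times depends on [x]. *)
apply: (emeasurable_fun_cvg (fun n x => n.+1%:R%:E *
  \int[lebesgue_measure]_(t in `]0%R, n.+1%:R^-1%R[) \int[Px x]_w g (path_at t w))).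
  by move=> n; apply: measurable_funeM; exact: measurable_occupation.
move=> x _; have [j -> jP] := J_right_limit mA (Zoo x) mtau tau0 mN tauE.
apply: cvg_right_average.
- exact: measurable_time_marginal.
- by move=> t; exact: integral_ge0.
- move=> e /jP[eta eta0 h]; exists eta => //.
  have := zero_potential_ae hP x (measurable_charged mN) zN.
  apply: ae_impl => t good /andP[t0 t1]; apply: h; first by rewrite t0.
  exact/good/ltW.
Qed.
End main.

Theorem corollary2p1 (R : realType) (d : nat)
    (P : R -> R.-pker (euclidean R d) ~> (euclidean R d))
    (Px : R.-pker (euclidean R d) ~> (path_space R d))
    (f : 'rV[R]_d -> R) (delta : R -> R) :
  continuous_strong_markov Px P ->
  continuous f ->
  (forall x, (0 <= f x)%R) ->
  discount_function delta ->
  (exists lambda : {sfinite_measure set (euclidean R d) -> \bar R},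
     is_reference_measure P lambda) ->
  (forall x : euclidean R d,
     completed_expectation Px x (payoff_sup delta f) < +oo) ->
  forall A : set (euclidean R d), measurable A ->
    measurable (Theta Px delta f A).
Proof.
move=> hP cf f0 hdelta ref Zoo A mA.
have mJ := measurable_J hP cf f0 hdelta ref Zoo mA.
have mf : measurable_fun setT (fun x : euclidean R d => (f x)%:E).
  by apply/measurable_EFinP; exact: measurable_continuous_euclidean.
apply: measurableU; last apply: measurableI => //.
- by have := measurable_lte measurableT mJ mf; rewrite setTI.
- by have := measurable_eqe measurableT mJ mf; rewrite setTI.
Qed.
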